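(* Let $\mathcal{G}$ be a finite connected groupoid, $x\in\mathcal{G}_0$, $\tau(x)=\{\tau_y\}_{y\in\mathcal{G}_0}$ a transversal for $x$, $A$ a ring, and $\gamma=(I,\gamma_{\tau(x)},\gamma_{(x)})$ an object of $\mathsf{D}_{\mathcal{G},\tau(x)}(A)$ such that $I_{\tau_y^{-1}}=I_x$ and $I_{\tau_y}=I_y$ for all $y\in\mathcal{G}_0$, $I_x$ is unital, $\gamma_{(x)}$ is a unital partial action, and $A=\bigoplus_{y\in\mathcal{G}_0}I_y$. Let $\theta=\mathtt{Ext}(\gamma)=(B_g,\theta_g)_{g\in\mathcal{G}}$, $\theta_{(x)}=(B_h,\theta_h)_{h\in\mathcal{G}(x)}$, $R=A\star_\theta\mathcal{G}$ and $S=B_x\star_{\theta_{(x)}}\mathcal{G}(x)$. Let $U=R1_S$ (an $(R,S)$-bimodule), $V=1_SR$ (an $(S,R)$-bimodule), $\mu:U\otimes_SV\to R$, $u\otimes v\mapsto uv$, and $\nu:V\otimes_RU\to S$, $v\otimes u\mapsto vu$. Then the sixtuple $(A\star_\theta\mathcal{G},\,B_x\star_{\theta_{(x)}}\mathcal{G}(x),\,U,\,V,\,\mu,\,\nu)$ is a strict Morita context; i.e., $A\star_\theta\mathcal{G}$ and $B_x\star_{\theta_{(x)}}\mathcal{G}(x)$ are Morita equivalent.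
   Context: Rings are associative and not necessarily unital; ideals are two-sided. A groupoid $\mathcal{G}$ is a small category in which every morphism is an isomorphism; $g\in\mathcal{G}$ means $g$ is a morphism; $\mathcal{G}_0$ is the set of objects, each object being identified with its identity morphism; $s(g),t(g)$ are source and target; composition is written right to left, so $gh$ is defined iff $s(g)=t(h)$. $\mathcal{G}(x,y)=\{g\in\mathcal{G}: s(g)=x,\ t(g)=y\}$ and $\mathcal{G}(x)=\mathcal{G}(x,x)$. $\mathcal{G}$ is connected if $\mathcal{G}(x,y)\neq\emptyset$ for all $x,y\in\mathcal{G}_0$. A partial action of $\mathcal{G}$ on a ring $A$ is a family $\alpha=(A_g,\alpha_g)_{g\in\mathcal{G}}$ such that: (P1) for each $g$, $A_{t(g)}$ is an ideal of $A$, $A_g$ is an ideal of $A_{t(g)}$ and $\alpha_g:A_{g^{-1}}\to A_g$ is a ring isomorphism; (P2) $\alpha_x=\mathrm{id}_{A_x}$ for $x\in\mathcal{G}_0$; (P3) $\alpha_h^{-1}(A_{g^{-1}}\cap A_h)\subseteq A_{(gh)^{-1}}$ whenever $s(g)=t(h)$; (P4) $\alpha_g(\alpha_h(a))=\alpha_{gh}(a)$ for all $a\in\alpha_h^{-1}(A_{g^{-1}}\cap A_h)$ whenever $s(g)=t(h)$. It is unital if every $A_g$ is a unital ring. A partial action of a group $H$ on a ring $I$ is a partial action of $H$ viewed as a one-object groupoid, the ideal attached to the identity of $H$ being $I$ itself. A transversal for $x\in\mathcal{G}_0$ is a family $\tau(x)=\{\tau_y\}_{y\in\mathcal{G}_0}$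 with $\tau_y\in\mathcal{G}(x,y)$ and $\tau_x=x$. For $g\in\mathcal{G}$ put $g_x:=\tau_{t(g)}^{-1}g\tau_{s(g)}\in\mathcal{G}(x)$. Composition of partial bijections $f:X\to Y$, $f':X'\to Y'$ of a set is $f'f:f^{-1}(X'\cap Y)\to f'(X'\cap Y)$. An object of $\mathsf{D}_{\mathcal{G},\tau(x)}(A)$ is a triple $(I,\gamma_{\tau(x)},\gamma_{(x)})$ where: $I=\{I_y\}_{y\in\mathcal{G}_0}$ is a family of ideals of $A$; $\gamma_{\tau(x)}=\{\gamma_{\tau_y}:I_{\tau_y^{-1}}\to I_{\tau_y}\}_{y\in\mathcal{G}_0}$ is a family of ring isomorphisms with $I_{\tau_y^{-1}}$ an ideal of $I_x$, $I_{\tau_y}$ an ideal of $I_y$, and $\gamma_{\tau_x}=\gamma_x=\mathrm{id}_{I_x}$; $\gamma_{(x)}=(I_h,\gamma_h)_{h\in\mathcal{G}(x)}$ is a partial action of the group $\mathcal{G}(x)$ on $I_x$; and for all $g\in\mathcal{G}$ the set $\gamma_{\tau_{t(g)}}\big(I_{\tau_{t(g)}^{-1}}\cap\gamma_{g_x}(I_{\tau_{s(g)}^{-1}}\cap I_{g_x^{-1}})\big)$ is an ideal of $I_{t(g)}$. $\mathtt{Ext}(\gamma)$ is the partial action $\theta=(B_g,\theta_g)_{g\in\mathcal{G}}$ of $\mathcal{G}$ on $A$ with $\theta_y=\mathrm{id}_{I_y}$ for $y\in\mathcal{G}_0$, $\theta_g=\gamma_{\tau_{t(g)}}\gamma_{g_x}\gamma_{\tau_{s(g)}}^{-1}$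 (composition of partial bijections) for $g\notin\mathcal{G}_0$, and $B_g$ the range of $\theta_g$. In the present setting each $B_g$ is unital, and its identity $1_g=\gamma_{\tau_{t(g)}}(1_{g_x})$ is a central idempotent of $A$ with $B_g=A1_g$; moreover $\theta_{(x)}=\gamma_{(x)}$ and $B_x=I_x$. The partial skew groupoid ring $A\star_\theta\mathcal{G}$ is the set of formal sums $\sum_{g\in\mathcal{G}}b_g\delta_g$, $b_g\in B_g$, with the usual addition and multiplication determined by $(b_g\delta_g)(b'_h\delta_h)=b_g\theta_g(b'_h1_{g^{-1}})\delta_{gh}$ if $s(g)=t(h)$ and $0$ otherwise. The partial skew group ring $B_x\star_{\theta_{(x)}}\mathcal{G}(x)$ is defined in the same way from $\theta_{(x)}$ and is regarded as a subset of $A\star_\theta\mathcal{G}$. Their identities are $1_R=\sum_{y\in\mathcal{G}_0}1_y\delta_y$ and $1_S=1_x\delta_x$. A Morita context is a sixtuple $(R,S,U,V,\mu,\nu)$ with $R,S$ unital rings, bimodules ${}_RU_S$, ${}_SV_R$ and bimodule maps $\mu:U\otimes_SV\to R$, $\nu:V\otimes_RU\to S$ satisfying $u\,\nu(v\otimes u')=\mu(u\otimes v)u'$ and $v\,\mu(u\otimes v')=\nu(v\otimes u)v'$. It is strict if $\mu$ and $\nu$ are isomorphisms. *)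

(* Defs.v *)
From HB Require Import structures.
From mathcomp Require Import all_boot all_algebra.
From mathcomp Require Import boolp classical_sets functions.
From mathcomp.multinomials Require Import freeg.

Set Implicit Arguments.
Unset Strict Implicit.
Unset Printing Implicit Defensive.

Import GRing.Theory.
Local Open Scope ring_scope.
Local Open Scope classical_set_scope.

HB.mixin Record Zmodule_isRng A of GRing.Zmodule A := {
  rngmul : A -> A -> A;
  rngmulA : associative rngmul;
  rngmulDl : left_distributive rngmul +%R;
  rngmulDr : right_distributive rngmul +%R
}.

#[short(type="rngType")]
HB.structure Definition Rng := {A of Zmodule_isRng A & GRing.Zmodule A}.

Notation "a ** b" := (rngmul a b) (at level 40, left associativity) : ring_scope.

Section RngTheory.
Variable A : rngType.
Implicit Types (a b : A) (J K D : set A).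

Lemma rngmul0l a : 0 ** a = 0.
Proof. by apply: (addrI (0 ** a)); rewrite -rngmulDl !addr0. Qed.

Lemma rngmul0r a : a ** 0 = 0.
Proof. by apply: (addrI (a ** 0)); rewrite -rngmulDr !addr0. Qed.

Lemma rngmulNl a b : (- a) ** b = - (a ** b).
Proof. by apply: (addrI (a ** b)); rewrite -rngmulDl !subrr rngmul0l. Qed.

Lemma rngmulNr a b : a ** (- b) = - (a ** b).
Proof. by apply: (addrI (a ** b)); rewrite -rngmulDr !subrr rngmul0r. Qed.

Lemma rngmul_suml (T : Type) (r : seq T) (P : pred T) (F : T -> A) b :
  (\sum_(i <- r | P i) F i) ** b = \sum_(i <- r | P i) F i ** b.
Proof.
elim/big_rec2: _ => [|i y1 y2 _ <-]; first by rewrite rngmul0l.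
by rewrite rngmulDl.
Qed.

Lemma rngmul_sumr (T : Type) (r : seq T) (P : pred T) (F : T -> A) b :
  b ** (\sum_(i <- r | P i) F i) = \sum_(i <- r | P i) b ** F i.
Proof.
elim/big_rec2: _ => [|i y1 y2 _ <-]; first by rewrite rngmul0r.
by rewrite rngmulDr.
Qed.

(** Subrings of [A] are represented by their underlying sets; [ideal_in J D]
    says that [J] is a two-sided ideal of the ring [D]. *)
Definition ideal_in J D : Prop :=
  [/\ J `<=` D, J 0, (forall a b, J a -> J b -> J (a - b)) &
      (forall a b, D a -> J b -> J (a ** b) /\ J (b ** a))].

Definition is_identity J (e : A) : Prop :=
  J e /\ forall a, J a -> e ** a = a /\ a ** e = a.

Definition is_unital J : Prop := exists e, is_identity J e.

Definition one_of J : A := xget 0 [set e | is_identity J e].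

(** Only the values of [f] on [J] are relevant. *)
Definition ring_iso J K (f : A -> A) : Prop :=
  [/\ set_bij J K f,
      (forall a b, J a -> J b -> f (a + b) = f a + f b) &
      (forall a b, J a -> J b -> f (a ** b) = f a ** f b)].

Lemma one_ofP J : is_unital J -> is_identity J (one_of J).
Proof. by case=> e He; apply: (@xgetPex _ 0 [set e | is_identity J e]); exists e. Qed.

Lemma is_identity_uniq J e e' : is_identity J e -> is_identity J e' -> e = e'.
Proof. by move=> [He Pe] [He' Pe']; rewrite -(Pe' _ He).1 (Pe _ He').2. Qed.

Lemma idealD J D a b : ideal_in J D -> J a -> J b -> J (a + b).
Proof.
case=> _ J0 JB _ Ja Jb; rewrite -[b]opprK; apply: (JB) => //.
by rewrite -sub0r; apply: JB.
Qed.

Lemma idealB J D a b : ideal_in J D -> J a -> J b -> J (a - b).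
Proof. by case=> _ _ JB _; apply: JB. Qed.

Lemma ideal0 J D : ideal_in J D -> J 0.
Proof. by case. Qed.

Lemma idealMl J D a b : ideal_in J D -> D a -> J b -> J (a ** b).
Proof. by case=> _ _ _ JM Da Jb; have [] := JM a b Da Jb. Qed.

Lemma idealMr J D a b : ideal_in J D -> J a -> D b -> J (a ** b).
Proof. by case=> _ _ _ JM Ja Db; have [] := JM b a Db Ja. Qed.

Lemma idealS J D : ideal_in J D -> J `<=` D.
Proof. by case. Qed.

Lemma ideal_sum J D (T : Type) (r : seq T) (P : pred T) (F : T -> A) :
  ideal_in J D -> (forall i, P i -> J (F i)) -> J (\sum_(i <- r | P i) F i).
Proof.
move=> JD JF; apply: big_ind => //; first exact: ideal0 JD.
by move=> a b; apply: idealD JD.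
Qed.

Lemma iso_fun J K f a : ring_iso J K f -> J a -> K (f a).
Proof. by case=> -[fJK _ _] _ _; apply: fJK. Qed.

Lemma iso_inj J K f a b : ring_iso J K f -> J a -> J b -> f a = f b -> a = b.
Proof. by case=> -[_ fI _] _ _ Ja Jb; apply: fI; rewrite inE. Qed.

Lemma iso_surj J K f b : ring_iso J K f -> K b -> exists2 a, J a & f a = b.
Proof. by case=> -[_ _ fS] _ _ /fS[a Ja fa]; exists a. Qed.

Lemma isoD J K f a b : ring_iso J K f -> J a -> J b -> f (a + b) = f a + f b.
Proof. by case=> _ fD _; apply: fD. Qed.

Lemma isoM J K f a b : ring_iso J K f -> J a -> J b -> f (a ** b) = f a ** f b.
Proof. by case=> _ _; apply. Qed.

Lemma iso0 J K f : ring_iso J K f -> J 0 -> f 0 = 0.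
Proof.
move=> fJK J0; apply: (addrI (f 0)).
by rewrite addr0 -(isoD fJK) // addr0.
Qed.

Lemma iso_identity J K f e :
  ring_iso J K f -> is_identity J e -> is_identity K (f e).
Proof.
move=> fJK [Je Pe]; split; first exact: (iso_fun fJK).
move=> b /(iso_surj fJK)[a Ja <-].
by rewrite -!(isoM fJK) // (Pe a Ja).1 (Pe a Ja).2.
Qed.

Lemma set_bij_pinv J K f : set_bij J K f ->
  [/\ forall a, J a -> 'pinv_(fun=> 0) J f (f a) = a,
      forall b, K b -> f ('pinv_(fun=> 0) J f b) = b &
      forall b, K b -> J ('pinv_(fun=> 0) J f b)].
Proof.
case=> fJK fI fS.
have fK a : J a -> 'pinv_(fun=> 0) J f (f a) = a.
  by move=> Ja; apply: pinvKV; rewrite ?inE.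
split=> //.
- by move=> b /fS[a Ja <-]; rewrite fK.
- by move=> b /fS[a Ja <-]; rewrite fK.
Qed.

End RngTheory.

(** [A] is the internal direct sum of the [J i]. *)
Definition direct_sum (I : finType) (A : zmodType) (J : I -> set A) : Prop :=
  forall a : A, exists! f : {ffun I -> A},
    (forall i, J i (f i)) /\ \sum_i f i = a.

(** [gcomp] is total; it is only meaningful (and only constrained) on the
    composable pairs, i.e. those with [src g = tgt h]. *)
Record finGroupoid := FinGroupoid {
  Ob : finType;
  Mor :> finType;
  src : Mor -> Ob;
  tgt : Mor -> Ob;
  idm : Ob -> Mor;
  gcomp : Mor -> Mor -> Mor;
  ginv : Mor -> Mor;
  src_idm : forall y, src (idm y) = y;
  tgt_idm : forall y, tgt (idm y) = y;
  src_comp : forall g h, src g = tgt h -> src (gcomp g h) = src h;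
  tgt_comp : forall g h, src g = tgt h -> tgt (gcomp g h) = tgt g;
  gcompA : forall f g h, src f = tgt g -> src g = tgt h ->
    gcomp f (gcomp g h) = gcomp (gcomp f g) h;
  comp_idl : forall g, gcomp (idm (tgt g)) g = g;
  comp_idr : forall g, gcomp g (idm (src g)) = g;
  src_inv : forall g, src (ginv g) = tgt g;
  tgt_inv : forall g, tgt (ginv g) = src g;
  comp_invl : forall g, gcomp (ginv g) g = idm (src g);
  comp_invr : forall g, gcomp g (ginv g) = idm (tgt g)
}.

Definition connected_groupoid (G : finGroupoid) : Prop :=
  forall y z : Ob G, exists g : G, src g = y /\ tgt g = z.

Section GroupoidTheory.
Variable G : finGroupoid.
Implicit Types (g h k : G) (y : Ob G).

Lemma compKl g h : src g = tgt h -> gcomp (ginv g) (gcomp g h) = h.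
Proof.
by move=> gh; rewrite gcompA ?src_inv // comp_invl gh comp_idl.
Qed.

Lemma compVKl g h : tgt g = tgt h -> gcomp g (gcomp (ginv g) h) = h.
Proof.
by move=> gh; rewrite gcompA ?src_inv ?tgt_inv // comp_invr gh comp_idl.
Qed.

Lemma compVKr g h : src g = src h -> gcomp (gcomp g (ginv h)) h = g.
Proof. by move=> gh; rewrite -gcompA ?src_inv ?tgt_inv // comp_invl -gh comp_idr. Qed.

Lemma ginvK g : ginv (ginv g) = g.
Proof.
have := @compKl (ginv g) g; rewrite src_inv comp_invl => /(_ erefl).
by rewrite -(tgt_inv g) -(src_inv (ginv g)) comp_idr.
Qed.

Lemma inv_uniq g h : src g = tgt h -> gcomp g h = idm (tgt g) -> h = ginv g.
Proof.
move=> gh e; rewrite -(compKl gh) e -src_inv; exact: comp_idr.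
Qed.

Lemma inv_idm y : ginv (idm y) = idm y.
Proof.
apply/esym/inv_uniq; rewrite ?src_idm ?tgt_idm //.
by have := comp_idl (idm y); rewrite tgt_idm.
Qed.

Lemma inv_comp g h : src g = tgt h -> ginv (gcomp g h) = gcomp (ginv h) (ginv g).
Proof.
move=> gh; apply/esym/inv_uniq.
  by rewrite src_comp // tgt_comp ?src_inv ?tgt_inv.
have hg : src (ginv h) = tgt (ginv g) by rewrite src_inv tgt_inv.
rewrite -gcompA ?(tgt_comp hg) ?tgt_inv // compVKl ?tgt_inv //.
by rewrite comp_invr tgt_comp.
Qed.

End GroupoidTheory.

Section Isotropy.
Variables (G : finGroupoid) (x : Ob G).

Definition loop_at (g : G) : bool := (src g == x) && (tgt g == x).

Definition isoMor : finType := {g : G | loop_at g}.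
Definition mkLoop (g : G) (gx : loop_at g) : isoMor :=
  exist (fun g : G => loop_at g) g gx.

Lemma loopP (g : isoMor) : src (val g) = x /\ tgt (val g) = x.
Proof. by case: g => g /= /andP[/eqP-> /eqP->]. Qed.

Fact iso_idm_subproof : loop_at (idm x).
Proof. by rewrite /loop_at src_idm tgt_idm eqxx. Qed.

Fact iso_comp_subproof (g h : isoMor) : loop_at (gcomp (val g) (val h)).
Proof.
have [sg tg] := loopP g; have [sh th] := loopP h.
by rewrite /loop_at src_comp ?tgt_comp ?sg ?th // sh tg eqxx.
Qed.

Fact iso_inv_subproof (g : isoMor) : loop_at (ginv (val g)).
Proof.
by have [sg tg] := loopP g; rewrite /loop_at src_inv tgt_inv sg tg eqxx.
Qed.

Definition iso_idm : isoMor := mkLoop iso_idm_subproof.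
Definition iso_comp (g h : isoMor) : isoMor := mkLoop (iso_comp_subproof g h).
Definition iso_inv (g : isoMor) : isoMor := mkLoop (iso_inv_subproof g).

Definition isotropy : finGroupoid.
Proof.
apply: (@FinGroupoid unit isoMor (fun=> tt) (fun=> tt) (fun=> iso_idm)
          iso_comp iso_inv) => //.
- by case.
- by case.
- move=> f g h _ _; apply: val_inj => /=.
  by apply: gcompA; [rewrite (loopP f).1 (loopP g).2 | rewrite (loopP g).1 (loopP h).2].
- by move=> g; apply: val_inj => /=; rewrite -[RHS]comp_idl (loopP g).2.
- by move=> g; apply: val_inj => /=; rewrite -[RHS]comp_idr (loopP g).1.
- by move=> g; apply: val_inj => /=; rewrite comp_invl (loopP g).1.
- by move=> g; apply: val_inj => /=; rewrite comp_invr (loopP g).2.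
Defined.

End Isotropy.

(** A partial action of [G] on the ring [D], a subring of [A]. The ring [A_g]
    is [pdom g]; [pact g] is a total function on [A] of which only the values
    on [A_{g^-1}] are relevant. *)
Record partial_action (G : finGroupoid) (A : rngType) (D : set A) :=
  PartialAction {
  pdom : G -> set A;
  pact : G -> A -> A;
  pdom_tgt_ideal : forall g, ideal_in (pdom (idm (tgt g))) D;
  pdom_ideal : forall g, ideal_in (pdom g) (pdom (idm (tgt g)));
  pact_iso : forall g, ring_iso (pdom (ginv g)) (pdom g) (pact g);
  pact_idm : forall y a, pdom (idm y) a -> pact (idm y) a = a;
  pact_domP : forall g h, src g = tgt h ->
    pdom (ginv h) `&` (pact h @^-1` (pdom (ginv g) `&` pdom h))
      `<=` pdom (ginv (gcomp g h));
  pact_comp : forall g h, src g = tgt h ->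
    forall a, (pdom (ginv h) `&` (pact h @^-1` (pdom (ginv g) `&` pdom h))) a ->
    pact g (pact h a) = pact (gcomp g h) a
}.

Definition unital_action (G : finGroupoid) (A : rngType) (D : set A)
    (alpha : partial_action G D) : Prop :=
  forall g, is_unital (pdom alpha g).

Record unital_partial_action (G : finGroupoid) (A : rngType) (D : set A) :=
  UnitalPartialAction {
  upaction :> partial_action G D;
  upactionP : unital_action upaction
}.

Section PartialActionTheory.
Variables (G : finGroupoid) (A : rngType) (D : set A).
Variable alpha : partial_action G D.
Implicit Types (g h : G) (a : A).
Local Notation d := (pdom alpha).
Local Notation p := (pact alpha).

Lemma pdom_idm_ideal y : ideal_in (d (idm y)) D.
Proof. by have := pdom_tgt_ideal alpha (idm y); rewrite tgt_idm. Qed.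

Lemma pdomV_ideal g : ideal_in (d (ginv g)) (d (idm (src g))).
Proof. by have := pdom_ideal alpha (ginv g); rewrite tgt_inv. Qed.

Lemma pdomV_src g a : d (ginv g) a -> d (idm (src g)) a.
Proof. exact: (idealS (pdomV_ideal g)). Qed.

Lemma pdom_tgt g a : d g a -> d (idm (tgt g)) a.
Proof. exact: (idealS (pdom_ideal alpha g)). Qed.

Lemma pdom_D g a : d g a -> D a.
Proof. by move/pdom_tgt; apply: (idealS (pdom_idm_ideal _)). Qed.

Lemma pact_mem g a : d (ginv g) a -> d g (p g a).
Proof. exact: (iso_fun (pact_iso alpha g)). Qed.

Lemma pactV_mem g a : d g a -> d (ginv g) (p (ginv g) a).
Proof. by move=> da; apply: pact_mem; rewrite ginvK. Qed.

Lemma pact_dom g h a : src g = tgt h -> d (ginv h) a -> d (ginv g) (p h a) ->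
  d (ginv (gcomp g h)) a.
Proof.
move=> gh da dga; apply: (pact_domP gh); split=> //; split=> //.
exact: pact_mem.
Qed.

Lemma pactC g h a : src g = tgt h -> d (ginv h) a -> d (ginv g) (p h a) ->
  p g (p h a) = p (gcomp g h) a.
Proof.
move=> gh da dga; apply: pact_comp => //; split=> //; split=> //.
exact: pact_mem.
Qed.

Lemma pactK g a : d (ginv g) a -> p (ginv g) (p g a) = a.
Proof.
move=> da; rewrite pactC ?src_inv // ?ginvK; last exact: pact_mem.
by rewrite comp_invl pact_idm //; apply: pdomV_src.
Qed.

Lemma pactVK g a : d g a -> p g (p (ginv g) a) = a.
Proof. by move=> da; have := @pactK (ginv g) a; rewrite ginvK; apply. Qed.

Lemma pact_img g h a : src g = tgt h -> d (ginv g) a -> d h a -> d (gcomp g h) (p g a).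
Proof.
move=> gh da dh.
have := @pact_dom (ginv h) (ginv g) (p g a).
rewrite src_inv tgt_inv !ginvK -inv_comp ?ginvK // pactK //; apply => //.
exact: pact_mem.
Qed.

End PartialActionTheory.

Section SkewRing.
Variables (G : finGroupoid) (A : rngType) (D : set A).
Variable alpha : unital_partial_action G D.
Implicit Types (g h k : G) (a b c : A).
Local Notation d := (pdom alpha).
Local Notation p := (pact alpha).

(** The identity of the ring [A_g]. *)
Definition pone g : A := one_of (d g).

Lemma poneP g : is_identity (d g) (pone g).
Proof. exact/one_ofP/upactionP. Qed.

Lemma pone_mem g : d g (pone g). Proof. by case: (poneP g). Qed.

Lemma pone1l g a : d g a -> pone g ** a = a.
Proof. by move=> da; have [_ /(_ a da)[]] := poneP g. Qed.

Lemma pone1r g a : d g a -> a ** pone g = a.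
Proof. by move=> da; have [_ /(_ a da)[]] := poneP g. Qed.

Lemma pone_central g a : d (idm (tgt g)) a -> pone g ** a = a ** pone g.
Proof.
move=> da; have I := pdom_ideal alpha g; have d1 := pone_mem g.
rewrite -[LHS](@pone1r g); last exact: idealMr I _ _.
by rewrite -rngmulA pone1l //; apply: idealMl I _ _.
Qed.

(** [a] in [A_{s(g)}] is sent to [alpha_g(a 1_{g^-1})]. *)
Definition tact g a : A := p g (a ** pone (ginv g)).

Lemma tact_dom g a : d (idm (src g)) a -> d (ginv g) (a ** pone (ginv g)).
Proof. by move=> da; apply: idealMl (pdomV_ideal alpha g) _ _ => //; apply: pone_mem. Qed.

Lemma tact_mem g a : d (idm (src g)) a -> d g (tact g a).
Proof. by move=> da; apply: pact_mem; apply: tact_dom. Qed.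

Lemma tactE g a : d (ginv g) a -> tact g a = p g a.
Proof. by move=> da; rewrite /tact pone1r. Qed.

Lemma tactD g a b : d (idm (src g)) a -> d (idm (src g)) b ->
  tact g (a + b) = tact g a + tact g b.
Proof.
by move=> da db; rewrite /tact rngmulDl (isoD (pact_iso alpha g)) //; apply: tact_dom.
Qed.

Lemma tact0 g : tact g 0 = 0.
Proof.
rewrite /tact rngmul0l (iso0 (pact_iso alpha g)) //.
exact: ideal0 (pdomV_ideal alpha g).
Qed.

Lemma tact_sum g (T : Type) (r : seq T) (P : pred T) (F : T -> A) :
  (forall i, P i -> d (idm (src g)) (F i)) ->
  tact g (\sum_(i <- r | P i) F i) = \sum_(i <- r | P i) tact g (F i).
Proof.
move=> dF; pose K a b := d (idm (src g)) a /\ tact g a = b.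
suff [] : K (\sum_(i <- r | P i) F i) (\sum_(i <- r | P i) tact g (F i)) by [].
apply: big_rec2 => [|i b a Pi [db <-]].
  by split; [apply: ideal0 (pdom_idm_ideal _ _) | apply: tact0].
split; first exact: idealD (pdom_idm_ideal _ _) (dF i Pi) db.
by rewrite tactD //; apply: dF.
Qed.

Lemma tactM g a b : d (idm (src g)) a -> d (idm (src g)) b ->
  tact g (a ** b) = tact g a ** tact g b.
Proof.
move=> da db; rewrite /tact -(isoM (pact_iso alpha g)); try exact: tact_dom.
congr p; rewrite -!rngmulA; congr (_ ** _).
by rewrite pone1l //; apply: tact_dom.
Qed.

Lemma tact_img g h b : src g = tgt h -> d h b -> d (gcomp g h) (tact g b).
Proof.
move=> gh db; have db' : d (idm (src g)) b by rewrite gh; apply: pdom_tgt.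
apply: pact_img => //; first exact: tact_dom.
apply: idealMr (pdom_ideal alpha h) db _.
by rewrite -gh -tgt_inv; apply: pdom_tgt; apply: pone_mem.
Qed.

Lemma tact_comp g h c : src g = tgt h -> d (idm (src h)) c ->
  tact g (tact h c) = pone g ** tact (gcomp g h) c.
Proof.
move=> gh dc.
have dIh := pdom_ideal alpha h; rewrite -gh in dIh.
have dIg := pdomV_ideal alpha g.
have dIgh := pdomV_ideal alpha (gcomp g h); rewrite src_comp // in dIgh.
have h1 := pone_mem h; have g1 := pone_mem (ginv g).
have mem_gh a b : d h a -> d (ginv g) b -> d h (a ** b) /\ d (ginv g) (a ** b).
  move=> da db; split; first exact: idealMr dIh da (idealS dIg db).
  exact: idealMl dIg (idealS dIh da) db.
pose w0 := pone h ** pone (ginv g); pose e := p (ginv h) w0.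
have [w0h w0g] := mem_gh _ _ h1 g1.
have he : p h e = w0 by rewrite /e pactVK.
have deh : d (ginv h) e by apply: pactV_mem.
have degh : d (ginv (gcomp g h)) e by apply: pact_dom => //; rewrite he.
pose c1 := c ** pone (ginv h).
have dc1 : d (ginv h) c1 by apply: tact_dom.
have hc1e : p h (c1 ** e) = tact h c ** pone (ginv g).
  rewrite (isoM (pact_iso alpha h)) // he rngmulA [_ ** pone h]pone1r //.
  exact: pact_mem.
have dc1e : d (ginv h) (c1 ** e).
  by apply: idealMr (pdomV_ideal alpha h) dc1 _; apply: pdomV_src.
have dg1e : d (ginv g) (p h (c1 ** e)).
  rewrite hc1e; apply: (mem_gh _ _ _ g1).2; exact: tact_mem.
rewrite {1}/tact -hc1e pactC //.
have -> : c1 ** e = (c ** pone (ginv (gcomp g h))) ** e.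
  by rewrite -!rngmulA !pone1l.
have dgt : d (ginv (gcomp g h)) (c ** pone (ginv (gcomp g h))).
  by apply: tact_dom; rewrite src_comp.
rewrite (isoM (pact_iso alpha (gcomp g h))) //.
rewrite -[p (gcomp g h) (_ ** _)]/(tact (gcomp g h) c).
have dy : d (gcomp g h) (tact (gcomp g h) c) by apply: tact_mem; rewrite src_comp.
set y := tact _ _ in dy *.
rewrite -pactC ?he //.
have tgh : tgt (gcomp g h) = tgt g by rewrite tgt_comp.
have dIg' := pdom_ideal alpha g.
have dIgh' := pdom_ideal alpha (gcomp g h); rewrite tgh in dIgh'.
have dyt : d (idm (tgt g)) y by apply: idealS dIgh' _ dy.
have dq : d g (p g w0) by apply: pact_mem.
rewrite -[p g w0](@pone1l g) // rngmulA -pone_central //.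
have dzg : d g (pone g ** y) by apply: idealMr dIg' _ dyt; apply: pone_mem.
have dzgh : d (gcomp g h) (pone g ** y).
  by apply: idealMl dIgh' _ dy; apply: pdom_tgt; apply: pone_mem.
set z := pone g ** y in dzg dzgh *.
have dz' : d h (p (ginv g) z).
  have := @pact_img _ _ _ alpha (ginv g) (gcomp g h) z.
  by rewrite compKl // ginvK; apply => //; rewrite src_inv tgt_comp.
rewrite -{1}(pactVK dzg) -(isoM (pact_iso alpha g)) //; last exact: pactV_mem.
rewrite /w0 rngmulA [_ ** pone h]pone1r // pone1r; last exact: pactV_mem.
by rewrite pactVK.
Qed.

Definition skew_pred : {pred {ffun G -> A}} :=
  fun f => `[< forall g, d g (f g) >].

Fact skew_zmod_closed : zmod_closed skew_pred.
Proof.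
split=> [|f f' /asboolP df /asboolP df']; apply/asboolP => g.
  by rewrite ffunE; apply: ideal0 (pdom_ideal alpha g).
by rewrite !ffunE; apply: idealB (pdom_ideal alpha g) _ _.
Qed.
HB.instance Definition _ :=
  GRing.isZmodClosed.Build {ffun G -> A} skew_pred skew_zmod_closed.

(** Formal sums of the [b_g delta_g], [b_g] in [A_g], given by the family of
    their coefficients. *)
Record skew_ring := SkewRing { coefs :> {ffun G -> A}; _ : coefs \in skew_pred }.

HB.instance Definition _ := [isSub for coefs].
HB.instance Definition _ := [Choice of skew_ring by <:].
HB.instance Definition _ := [SubChoice_isSubZmodule of skew_ring by <:].

Lemma skewP (f : skew_ring) g : d g (f g).
Proof. by case: f => f /= /asboolP. Qed.

Lemma skew_eqP (f f' : skew_ring) : (forall g, f g = f' g) -> f = f'.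
Proof. by move=> e; apply: val_inj; apply/ffunP. Qed.

Lemma skewDE (f f' : skew_ring) g : (f + f') g = f g + f' g.
Proof. by rewrite ffunE. Qed.

Lemma skew0E g : (0 : skew_ring) g = 0.
Proof. by rewrite ffunE. Qed.

(** [(b delta_g) (b' delta_h) = b alpha_g(b' 1_{g^-1}) delta_{gh}] when [gh] is
    defined, and [0] otherwise. *)
Definition skew_mul_fun (f f' : {ffun G -> A}) : {ffun G -> A} :=
  [ffun k => \sum_(g : G) \sum_(h : G | (src g == tgt h) && (gcomp g h == k))
               f g ** p g (f' h ** pone (ginv g))].

Fact skew_mul_subproof (f f' : skew_ring) : skew_mul_fun f f' \in skew_pred.
Proof.
apply/asboolP=> k; rewrite ffunE; apply: ideal_sum (pdom_ideal alpha k) _ => g _.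
apply: ideal_sum (pdom_ideal alpha k) _ => h /andP[/eqP gh /eqP <-].
apply: idealMl (pdom_ideal alpha (gcomp g h)) _ _.
  by rewrite tgt_comp //; apply: pdom_tgt; apply: skewP.
by apply: tact_img => //; apply: skewP.
Qed.

Definition skew_mul (f f' : skew_ring) : skew_ring := SkewRing (skew_mul_subproof f f').

(** The identity is the sum of the [1_y delta_y], [y] ranging over objects. *)
Definition skew_one_fun : {ffun G -> A} :=
  [ffun g => if g == idm (src g) then pone g else 0].

Fact skew_one_subproof : skew_one_fun \in skew_pred.
Proof.
apply/asboolP=> g; rewrite ffunE; case: ifP => _; first exact: pone_mem.
exact: ideal0 (pdom_ideal alpha g).
Qed.

Definition skew_one : skew_ring := SkewRing skew_one_subproof.

Lemma skew_srcP (f : skew_ring) g h : src g = tgt h -> d (idm (src g)) (f h).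
Proof. by move=> ->; apply: pdom_tgt; apply: skewP. Qed.

Lemma skew_mulE (f f' : skew_ring) k : skew_mul f f' k =
  \sum_(g : G | tgt g == tgt k) f g ** tact g (f' (gcomp (ginv g) k)).
Proof.
rewrite ffunE big_mkcond [RHS]big_mkcond; apply: eq_bigr => g _ /=.
case: eqP => [tgk|ntgk]; last first.
  by rewrite big1 // => h /andP[/eqP gh /eqP e]; case: ntgk; rewrite -e tgt_comp.
rewrite (big_pred1 (gcomp (ginv g) k)) // => h.
apply/andP/eqP => [[/eqP gh /eqP <-]|->]; first by rewrite compKl.
by rewrite tgt_comp ?src_inv // tgt_inv compVKl // !eqxx.
Qed.

Fact skew_mulA : associative skew_mul.
Proof.
move=> f1 f2 f3; apply: skew_eqP => k; rewrite !skew_mulE.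
transitivity (\sum_(g : G | tgt g == tgt k) \sum_(h : G | tgt h == src g)
   f1 g ** tact g (f2 h) ** tact (gcomp g h) (f3 (gcomp (ginv (gcomp g h)) k))).
  apply: eq_bigr => g /eqP gk; rewrite skew_mulE tgt_comp ?src_inv // tgt_inv.
  rewrite tact_sum => [|h /eqP hg]; last first.
    rewrite -hg; apply: idealMr (pdom_idm_ideal _ _) _ _.
      by apply: pdom_tgt; apply: skewP.
    apply: (idealS (pdom_idm_ideal alpha (tgt h))); apply: pdom_tgt.
    apply: tact_mem; apply: skew_srcP.
    by rewrite tgt_comp ?src_inv // ?tgt_inv // hg -tgt_inv tgt_comp // src_inv.
  rewrite rngmul_sumr; apply: eq_bigr => h /eqP hg.
  have hk : tgt (gcomp (ginv g) k) = tgt h by rewrite tgt_comp ?src_inv // tgt_inv.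
  have d3 : d (idm (src h)) (f3 (gcomp (ginv h) (gcomp (ginv g) k))).
    by apply: skew_srcP; rewrite tgt_comp ?src_inv // tgt_inv.
  have d2 : d (idm (src g)) (f2 h) by apply: skew_srcP.
  rewrite tactM //; last by rewrite -hg; apply: pdom_tgt; apply: tact_mem.
  rewrite tact_comp // rngmulA rngmulA -[f1 g ** _ ** pone g]rngmulA pone1r; last exact: tact_mem.
  by rewrite inv_comp // -gcompA ?src_inv ?tgt_inv.
under [RHS]eq_bigr => m _.
  rewrite skew_mulE rngmul_suml.
  over.
rewrite /= [RHS](exchange_big_dep (fun g => tgt g == tgt k)) /=; last first.
  by move=> m g /eqP e /eqP ->; rewrite e.
apply: eq_bigr => g /eqP gk.
rewrite [RHS](reindex_onto (gcomp g) (gcomp (ginv g))) /=; last first.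
  by move=> m /andP[_ /eqP gm]; rewrite compVKl.
apply: eq_big => [h|h /eqP hg]; last by rewrite compKl.
apply/idP/idP => [/eqP hg|/andP[/andP[_ /eqP e] /eqP <-]].
  by rewrite compKl // tgt_comp // gk !eqxx.
by rewrite tgt_comp ?src_inv // tgt_inv.
Qed.

Fact skew_mul1l : left_id skew_one skew_mul.
Proof.
move=> f; apply: skew_eqP => k; rewrite skew_mulE.
rewrite (bigD1 (idm (tgt k))) ?tgt_idm //= big1 ?addr0; last first.
  move=> g /andP[/eqP gk gN1]; rewrite ffunE ifN ?rngmul0l //.
  by apply: contra gN1 => /eqP e; rewrite e -gk {2}e tgt_idm.
have dk := skewP f k.
have d1 : d (idm (tgt k)) (f k) by apply: pdom_tgt.
rewrite ffunE src_idm eqxx inv_idm comp_idl tactE ?inv_idm // pact_idm //.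
by rewrite pone1l.
Qed.

Fact skew_mul1r : right_id skew_one skew_mul.
Proof.
move=> f; apply: skew_eqP => k; rewrite skew_mulE.
rewrite (bigD1 k) //= big1 ?addr0; last first.
  move=> g /andP[/eqP gk gNk]; rewrite ffunE ifN ?tact0 ?rngmul0r //.
  apply: contra gNk => /eqP e; rewrite -[g]comp_idr.
  have sg : src k = src g.
    have := congr1 (@tgt G) e; rewrite tgt_idm tgt_comp ?src_inv // tgt_inv.
    by rewrite src_comp ?src_inv.
  rewrite -sg; rewrite src_comp ?src_inv // in e.
  by rewrite -e compVKl.
rewrite ffunE comp_invl src_idm eqxx /tact pone1l; last first.
  by apply: pdomV_src; apply: pone_mem.
have K := iso_identity (pact_iso alpha k) (poneP (ginv k)).
by rewrite (K.2 _ (skewP f k)).2.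
Qed.

Fact skew_mulDl : left_distributive skew_mul +%R.
Proof.
move=> f1 f2 f3; apply: skew_eqP => k; rewrite skewDE !skew_mulE -big_split.
by apply: eq_bigr => g _; rewrite skewDE rngmulDl.
Qed.

Fact skew_mulDr : right_distributive skew_mul +%R.
Proof.
move=> f1 f2 f3; apply: skew_eqP => k; rewrite skewDE !skew_mulE -big_split.
apply: eq_bigr => g /eqP gk; rewrite skewDE tactD ?rngmulDr //;
  by apply: skew_srcP; rewrite tgt_comp ?src_inv ?tgt_inv.
Qed.

HB.instance Definition _ := GRing.Zmodule_isPzRing.Build skew_ring
  skew_mulA skew_mul1l skew_mul1r skew_mulDl skew_mulDr.

End SkewRing.

Section Restrict.
Variables (G : finGroupoid) (A : rngType) (D : set A).

Definition res_action (alpha : partial_action G D) (x : Ob G) :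
  partial_action (isotropy x) (pdom alpha (idm x)).
Proof.
apply: (@PartialAction (isotropy x) A _ (fun h => pdom alpha (val h))
          (fun h => pact alpha (val h))) => /=.
- move=> _; have I := pdom_idm_ideal alpha x.
  split=> [//| | |a b da db]; [exact: ideal0 I | by move=> a b; apply: idealB I|].
  have [aD bD] := (idealS I da, idealS I db).
  by split; [apply: idealMl I aD db | apply: idealMl I bD da].
- by move=> h; have := pdom_ideal alpha (val h); rewrite (loopP h).2.
- by move=> h; apply: pact_iso.
- by move=> _; apply: pact_idm.
- by move=> g h _; apply: pact_domP; rewrite (loopP g).1 (loopP h).2.
- by move=> g h _; apply: pact_comp; rewrite (loopP g).1 (loopP h).2.
Defined.

Definition res_uaction (alpha : unital_partial_action G D) (x : Ob G) :
    unital_partial_action (isotropy x) (pdom alpha (idm x)) :=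
  @UnitalPartialAction _ _ _ (res_action alpha x)
    (fun h => upactionP alpha (val h)).

End Restrict.

Record base_transversal (G : finGroupoid) (x : Ob G) := BaseTransversal {
  trv :> Ob G -> G;
  src_trv : forall y, src (trv y) = x;
  tgt_trv : forall y, tgt (trv y) = y;
  trv_base : trv x = idm x
}.

Section BaseLoop.
Variables (G : finGroupoid) (x : Ob G) (tau : base_transversal x).

Fact base_loop_subproof (g : G) :
  loop_at x (gcomp (ginv (tau (tgt g))) (gcomp g (tau (src g)))).
Proof.
have e1 : src g = tgt (tau (src g)) by rewrite tgt_trv.
have e2 : src (ginv (tau (tgt g))) = tgt (gcomp g (tau (src g))).
  by rewrite src_inv tgt_trv tgt_comp.
by rewrite /loop_at src_comp // src_comp // src_trv tgt_comp // tgt_inv src_trv eqxx.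
Qed.

(** [g_x = tau_{t(g)}^{-1} g tau_{s(g)}] *)
Definition base_loop (g : G) : isotropy x := mkLoop (base_loop_subproof g).

Lemma base_loop_inv g : base_loop (ginv g) = ginv (base_loop g).
Proof.
apply: val_inj => /=; rewrite src_inv tgt_inv.
have e1 : src g = tgt (tau (src g)) by rewrite tgt_trv.
have e2 : src (ginv (tau (tgt g))) = tgt (gcomp g (tau (src g))).
  by rewrite src_inv tgt_trv tgt_comp.
rewrite inv_comp // inv_comp // ginvK gcompA // ?src_inv ?tgt_inv ?src_trv ?tgt_trv //.
Qed.

Lemma base_loop_comp g h : src g = tgt h ->
  base_loop (gcomp g h) = gcomp (base_loop g) (base_loop h).
Proof.
move=> gh; apply: val_inj => /=; rewrite src_comp // tgt_comp // gh.
have e1 : src h = tgt (tau (src h)) by rewrite tgt_trv.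
have e2 : tgt (tau (tgt h)) = tgt (gcomp h (tau (src h))).
  by rewrite tgt_trv tgt_comp.
have e3 : src g = tgt (tau (tgt h)) by rewrite tgt_trv.
have e4 : src (tau (tgt h)) =
    tgt (gcomp (ginv (tau (tgt h))) (gcomp h (tau (src h)))).
  by rewrite tgt_comp ?tgt_inv // src_inv.
set m := tau (tgt h) in e2 e3 e4 *; set r := gcomp h _ in e2 e4 *.
have e5 : src (ginv (tau (tgt g))) = tgt (gcomp g m).
  by rewrite src_inv tgt_trv tgt_comp.
have e6 : src (gcomp g m) = tgt (gcomp (ginv m) r) by rewrite src_comp.
rewrite -(gcompA e5 e6) -(gcompA e3 e4) compVKl //.
by rewrite -(gcompA gh e1).
Qed.

End BaseLoop.

Section DObject.
Variables (G : finGroupoid) (x : Ob G) (tau : base_transversal x) (A : rngType).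

(** [dJ y] and [dK y] are [I_{tau_y^{-1}}] and [I_{tau_y}]. The ring on which
    the group [G(x)] acts is [I_x], which is moreover the ideal attached to the
    identity of [G(x)]. *)
Record Dobject := DObject {
  dI : Ob G -> set A;
  dJ : Ob G -> set A;
  dK : Ob G -> set A;
  dsig : Ob G -> A -> A;
  dgam : partial_action (isotropy x) (dI x);
  dI_ideal : forall y, ideal_in (dI y) [set: A];
  dJ_ideal : forall y, ideal_in (dJ y) (dI x);
  dK_ideal : forall y, ideal_in (dK y) (dI y);
  dsig_iso : forall y, ring_iso (dJ y) (dK y) (dsig y);
  dJ_base : dJ x = dI x;
  dK_base : dK x = dI x;
  dsig_base : forall a, dI x a -> dsig x a = a;
  dgam_base : pdom dgam (iso_idm x) = dI x;
  dgam_ideal : forall g : G,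
    let gx := base_loop tau g in
    ideal_in
      (dsig (tgt g) @`
        (dJ (tgt g) `&` (pact dgam gx @` (dJ (src g) `&` pdom dgam (ginv gx)))))
      (dI (tgt g))
}.

(** Partial bijections of [A]: the values of [pfun] outside of [psrc] are
    irrelevant. *)
Record pbij := PBij { psrc : set A; pfun : A -> A }.

Definition prange (f : pbij) : set A := pfun f @` psrc f.

Definition pcompose (f' f : pbij) : pbij :=
  PBij (psrc f `&` (pfun f @^-1` psrc f')) (pfun f' \o pfun f).

Definition pinverse (f : pbij) : pbij :=
  PBij (prange f) ('pinv_(fun=> 0) (psrc f) (pfun f)).

Variable gamma : Dobject.

(** The partial bijections [gamma_{tau_y}] and [gamma_h], [h] in [G(x)]. *)
Definition sig_pbij (y : Ob G) : pbij := PBij (dJ gamma y) (dsig gamma y).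

Definition gam_pbij (h : isotropy x) : pbij :=
  PBij (pdom (dgam gamma) (ginv h)) (pact (dgam gamma) h).

Definition ext_pbij (g : G) : pbij :=
  if g == idm (src g) then PBij (dI gamma (src g)) id
  else pcompose (pcompose (sig_pbij (tgt g)) (gam_pbij (base_loop tau g)))
                (pinverse (sig_pbij (src g))).

Let rel (g : G) (a b : A) : Prop := psrc (ext_pbij g) a /\ pfun (ext_pbij g) a = b.

Let nrel (g : G) (a b : A) : Prop := exists c,
  [/\ dJ gamma (src g) c, dsig gamma (src g) c = a,
      pdom (dgam gamma) (ginv (base_loop tau g)) c,
      dJ gamma (tgt g) (pact (dgam gamma) (base_loop tau g) c) &
      dsig gamma (tgt g) (pact (dgam gamma) (base_loop tau g) c) = b].

Let rel_id g a b : g = idm (src g) -> rel g a b <-> dI gamma (src g) a /\ a = b.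
Proof. by move=> e; rewrite /rel /ext_pbij -e eqxx. Qed.

Let rel_nid g a b : g != idm (src g) -> rel g a b <-> nrel g a b.
Proof.
move=> /negPf ne; rewrite /rel /ext_pbij ne /=.
have [bij _ _] := dsig_iso gamma (src g); have [K1 K2 K3] := set_bij_pinv bij.
split.
  case=> -[[c Jc <-]]; rewrite /= K1 // => -[dc Jgc] <-.
  by exists c; split => //; rewrite K1.
case=> c [Jc <- dc Jgc <-]; rewrite /= K1 //; split=> //.
by split; [exists c | split; rewrite /preimage /= ?K1].
Qed.

Let nid_inv (g : G) : g != idm (src g) -> ginv g != idm (src (ginv g)).
Proof.
apply: contra => /eqP e; have := congr1 (@ginv G) e.
by rewrite ginvK inv_idm => e'; rewrite e' src_idm.
Qed.

Let nrel_inv g a b : nrel g a b -> nrel (ginv g) b a.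
Proof.
case=> c [Jc <- dc Jgc <-]; exists (pact (dgam gamma) (base_loop tau g) c).
rewrite base_loop_inv ginvK src_inv tgt_inv pactK //; split=> //.
exact: pact_mem.
Qed.

Let rel_inv g a b : rel g a b -> rel (ginv g) b a.
Proof.
case: (eqVneq g (idm (src g))) => [e|ne].
  move/(rel_id _ _ e) => [Ia <-].
  have e' : ginv g = g by rewrite e inv_idm.
  by rewrite e'; apply/rel_id.
move/(rel_nid _ _ ne)/nrel_inv => r.
by apply/rel_nid => //; apply: nid_inv.
Qed.

Let rel_fun g a b b' : rel g a b -> rel g a b' -> b = b'.
Proof. by case=> _ <- [_ <-]. Qed.

Let rel_src g a b : rel g a b -> dI gamma (src g) a.
Proof.
case: (eqVneq g (idm (src g))) => [e|ne]; first by case/(rel_id _ _ e).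
case/(rel_nid _ _ ne) => c [Jc <- _ _ _].
by apply: (idealS (dK_ideal gamma _)); apply: iso_fun (dsig_iso gamma _) Jc.
Qed.

Let rel_comp g h a b c : src g = tgt h -> rel h a b -> rel g b c ->
  rel (gcomp g h) a c.
Proof.
move=> gh rh rg.
case: (eqVneq g (idm (src g))) => [e|ne].
  have -> : gcomp g h = h by rewrite e gh comp_idl.
  by case/(rel_id _ _ e): rg => _ <-.
case: (eqVneq h (idm (src h))) => [e|ne'].
  have -> : gcomp g h = g.
    by rewrite -[RHS]comp_idr gh e tgt_idm.
  by case/(rel_id _ _ e): rh => _ ->.
case: (eqVneq (gcomp g h) (idm (src (gcomp g h)))) => [e|ne2].
  have e' : g = ginv h.
    rewrite -[g](@compVKr _ g (ginv h)) ?src_inv // ginvK e src_comp //.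
    by rewrite -{1}tgt_inv comp_idl.
  have rg' := rel_inv rh; rewrite -e' in rg'.
  apply/rel_id => //; rewrite (rel_fun rg rg') src_comp //; split=> //.
  exact: rel_src rh.
have /(rel_nid _ _ ne')[u [Ju au du Jhu bu]] := rh.
have /(rel_nid _ _ ne)[v [Jv bv dv Jgv cv]] := rg.
apply/rel_nid => //; rewrite gh in Jv bv.
have uv : pact (dgam gamma) (base_loop tau h) u = v.
  by apply: (iso_inj (dsig_iso gamma (tgt h))) => //; rewrite bu bv.
rewrite -uv in dv Jgv cv.
exists u; rewrite base_loop_comp // src_comp // tgt_comp //.
by rewrite -pactC //; split=> //; apply: pact_dom.
Qed.

Let relD g a b a' b' : rel g a b -> rel g a' b' -> rel g (a + a') (b + b').
Proof.
case: (eqVneq g (idm (src g))) => [e|ne].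
  move/(rel_id _ _ e) => [Ia <-] /(rel_id _ _ e) [Ia' <-]; apply/rel_id => //.
  by split=> //; apply: idealD (dI_ideal gamma _) _ _.
case/(rel_nid _ _ ne) => c [Jc <- dc Jgc <-].
case/(rel_nid _ _ ne) => c' [Jc' <- dc' Jgc' <-].
apply/rel_nid => //; exists (c + c').
have gD := isoD (pact_iso (dgam gamma) (base_loop tau g)) dc dc'.
rewrite gD !(isoD (dsig_iso gamma _)) //; split=> //.
- exact: idealD (dJ_ideal gamma _) _ _.
- exact: idealD (pdom_ideal _ _) dc dc'.
- exact: idealD (dJ_ideal gamma _) _ _.
Qed.

Let relM g a b a' b' : rel g a b -> rel g a' b' -> rel g (a ** a') (b ** b').
Proof.
case: (eqVneq g (idm (src g))) => [e|ne].
  move/(rel_id _ _ e) => [Ia <-] /(rel_id _ _ e) [Ia' <-]; apply/rel_id => //.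
  by split=> //; apply: idealMl (dI_ideal gamma _) _ _.
case/(rel_nid _ _ ne) => c [Jc <- dc Jgc <-].
case/(rel_nid _ _ ne) => c' [Jc' <- dc' Jgc' <-].
apply/rel_nid => //; exists (c ** c').
have gM := isoM (pact_iso (dgam gamma) (base_loop tau g)) dc dc'.
rewrite gM !(isoM (dsig_iso gamma _)) //; split=> //.
- by apply: idealMl (dJ_ideal gamma _) (idealS (dJ_ideal gamma _) Jc) Jc'.
- by apply: idealMl (pdom_ideal _ _) (idealS (pdom_ideal _ _) dc) dc'.
- by apply: idealMl (dJ_ideal gamma _) (idealS (dJ_ideal gamma _) Jgc) Jgc'.
Qed.

Let dom_rel g a : prange (ext_pbij (ginv g)) a <-> rel g a (pfun (ext_pbij g) a).
Proof.
split=> [[b sb ba]|[sa _]].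
  have /rel_inv : rel (ginv g) b a by [].
  by rewrite ginvK => r; case: (r) => sa _.
by have [sb ba] := rel_inv (conj sa erefl); exists (pfun (ext_pbij g) a).
Qed.

Lemma prange_ext_id y : prange (ext_pbij (idm y)) = dI gamma y.
Proof. by rewrite /prange /ext_pbij src_idm eqxx /= image_id. Qed.

Let prange_nid g : g != idm (src g) -> prange (ext_pbij g) =
  dsig gamma (tgt g) @` (dJ gamma (tgt g) `&`
     (pact (dgam gamma) (base_loop tau g) @`
        (dJ gamma (src g) `&` pdom (dgam gamma) (ginv (base_loop tau g))))).
Proof.
move=> ne; apply/seteqP; split=> b /=.
  case=> a sa ab.
  have /(rel_nid _ _ ne)[c [Jc _ dc Jgc <-]] : rel g a b by [].
  by exists (pact (dgam gamma) (base_loop tau g) c) => //; split=> //; exists c.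
case=> z [Jgc [c [Jc dc] e]] <-; rewrite -{z}e in Jgc *.
have [sa ab] : rel g (dsig gamma (src g) c) (dsig gamma (tgt g)
    (pact (dgam gamma) (base_loop tau g) c)) by apply/rel_nid => //; exists c.
by exists (dsig gamma (src g) c).
Qed.

Definition Ext : partial_action G [set: A].
Proof.
apply: (@PartialAction G A _ (fun g => prange (ext_pbij g))
          (fun g => pfun (ext_pbij g))).
- by move=> g; rewrite prange_ext_id; apply: dI_ideal.
- move=> g; rewrite prange_ext_id; case: (eqVneq g (idm (src g))) => [e|ne].
    rewrite e prange_ext_id tgt_idm.
    split=> [//| | |a b Ia Ib]; [exact: ideal0 (dI_ideal _ _)
      | by move=> a b; apply: idealB (dI_ideal _ _) |].
    by split; apply: idealMl (dI_ideal _ _) _ _.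
  by rewrite prange_nid //; apply: dgam_ideal.
- move=> g; split.
  + split.
    * by move=> a /dom_rel[sa _]; exists a.
    * move=> a b; rewrite !inE => /dom_rel ra /dom_rel rb e; rewrite e in ra.
      exact: rel_fun (rel_inv ra) (rel_inv rb).
    * move=> b [a sa ab]; exists a => //; apply/dom_rel; exact: conj.
  + by move=> a b /dom_rel ra /dom_rel rb; have [_] := relD ra rb.
  + by move=> a b /dom_rel ra /dom_rel rb; have [_] := relM ra rb.
- by move=> y a _; rewrite /ext_pbij src_idm eqxx.
- move=> g h gh a [/dom_rel ra [/= /dom_rel rb _]].
  by have [sa e] := rel_comp gh ra rb; apply/dom_rel.
- move=> g h gh a [/dom_rel ra [/= /dom_rel rb _]].
  by have [sa e] := rel_comp gh ra rb.
Defined.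

Lemma Ext_unital :
  (forall y, dJ gamma y = dI gamma x /\ dK gamma y = dI gamma y) ->
  unital_action (dgam gamma) -> unital_action Ext.
Proof.
move=> hJK hu g /=; have hJ y := (hJK y).1.
have gI h : pdom (dgam gamma) h `<=` dI gamma x.
  by move=> a; apply: pdom_D.
have sub J y e : is_identity J e -> J `<=` dI gamma x ->
    is_unital (dsig gamma y @` J).
  move=> He JI; exists (dsig gamma y e); apply: (@iso_identity _ J) He.
  have JJ a : J a -> dJ gamma y a.
    by rewrite hJ; apply: JI.
  split.
  - split; [by move=> a Ja; exists a | | by []].
    move=> a b; rewrite !inE => Ja Jb.
    exact: iso_inj (dsig_iso gamma y) (JJ _ Ja) (JJ _ Jb).
  - by move=> a b Ja Jb; apply: (isoD (dsig_iso gamma y)); apply: JJ.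
  - by move=> a b Ja Jb; apply: (isoM (dsig_iso gamma y)); apply: JJ.
case: (eqVneq g (idm (src g))) => [e|ne].
  rewrite e prange_ext_id.
  have [e1 He1] := hu (iso_idm x); rewrite dgam_base in He1.
  have := sub _ (src g) _ He1 (fun _ => id).
  suff -> : dsig gamma (src g) @` dI gamma x = dI gamma (src g) by [].
  rewrite -(hJ (src g)) -(hJK (src g)).2.
  have [[fJK _ fS] _ _] := dsig_iso gamma (src g).
  by apply/seteqP; split=> [_ [a Ja <-]|]; [apply: fJK | apply: fS].
have [e1 He1] := hu (base_loop tau g).
have := sub _ (tgt g) _ He1 (gI _).
rewrite prange_nid // !hJ; congr (is_unital (_ @` _)).
apply/seteqP; split=> a /=.
  move=> da; split; first exact: gI da.
  exists (pact (dgam gamma) (ginv (base_loop tau g)) a); last exact: pactVK.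
  by have da' := pactV_mem da; split=> //; apply: gI da'.
by case=> _ [c [_ dc] <-]; apply: pact_mem.
Qed.

End DObject.

HB.mixin Record Lmodule_isBimodule (R S : pzRingType) M of GRing.Lmodule R M := {
  ract : M -> S -> M;
  ractDl : forall s m m', ract (m + m') s = ract m s + ract m' s;
  ractDr : forall m s s', ract m (s + s') = ract m s + ract m s';
  ractA : forall m s s', ract m (s * s') = ract (ract m s) s';
  ract1 : forall m, ract m 1 = m;
  ractZ : forall (r : R) m s, ract (r *: m) s = r *: ract m s
}.

#[short(type="bimodType")]
HB.structure Definition Bimodule (R S : pzRingType) :=
  {M of Lmodule_isBimodule R S M & GRing.Lmodule R M}.

Arguments ract {R S} {s} _ _ : rename.

Section Tensor.
Variables (R S : pzRingType) (M : bimodType R S) (N : lmodType S).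
Implicit Types (m : M) (n : N) (s : S) (r : R).

Local Notation "[ m ⊗ n ]" := << ((m : M), (n : N)) >>
  (at level 0, format "[ m  ⊗  n ]").

Inductive tensor_relator : {freeg (M * N)%type} -> Prop :=
| TRelDl m m' n : tensor_relator ([m + m' ⊗ n] - [m ⊗ n] - [m' ⊗ n])
| TRelDr m n n' : tensor_relator ([m ⊗ n + n'] - [m ⊗ n] - [m ⊗ n'])
| TRelA m s n : tensor_relator ([ract m s ⊗ n] - [m ⊗ s *: n]).

Definition tensor_ker : {pred {freeg (M * N)%type}} :=
  fun z => `[< forall P : set {freeg (M * N)%type},
    P 0 -> (forall z1 z2, P z1 -> P z2 -> P (z1 - z2)) ->
    tensor_relator `<=` P -> P z >].

Fact tensor_ker_zmod_closed : zmod_closed tensor_ker.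
Proof.
split=> [|z1 z2 /asboolP k1 /asboolP k2]; apply/asboolP => P P0 PB PR //.
by apply: (PB); [apply: k1 | apply: k2].
Qed.
HB.instance Definition _ :=
  GRing.isZmodClosed.Build {freeg (M * N)%type} tensor_ker tensor_ker_zmod_closed.

(** [M] tensored with [N] over [S], as a quotient of the free abelian group on
    [M * N]. *)
Definition tensor : Type := Quotient.quot tensor_ker.

Local Notation Q := (Quotient.quot tensor_ker).

HB.instance Definition _ := GRing.Zmodule.on tensor.

Definition tens (m : M) (n : N) : tensor := (\pi_Q)%qT [m ⊗ n].

Let rel_eq (z z' : {freeg (M * N)%type}) : tensor_relator (z - z') ->
  (\pi_Q)%qT z = (\pi_Q)%qT z' :> tensor.
Proof.
by move=> r; apply/eqP; rewrite -Quotient.idealrBE; apply/asboolP => P _ _; apply.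
Qed.

Let piD (z z' : {freeg (M * N)%type}) : (\pi_Q)%qT (z + z') =
  (\pi_Q)%qT z + (\pi_Q)%qT z' :> tensor.
Proof. by rewrite [LHS]raddfD. Qed.

Lemma tensDl m m' n : tens (m + m') n = tens m n + tens m' n.
Proof. by rewrite /tens -piD; apply: rel_eq; rewrite opprD addrA; apply: TRelDl. Qed.

Lemma tensDr m n n' : tens m (n + n') = tens m n + tens m n'.
Proof. by rewrite /tens -piD; apply: rel_eq; rewrite opprD addrA; apply: TRelDr. Qed.

Lemma tensA m s n : tens (ract m s) n = tens m (s *: n).
Proof. by apply: rel_eq; apply: TRelA. Qed.

Lemma tensor_ind (P : tensor -> Prop) : P 0 ->
  (forall t t', P t -> P t' -> P (t - t')) -> (forall m n, P (tens m n)) ->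
  forall t, P t.
Proof.
move=> P0 PB Pt t.
have PN u : P u -> P (- u) by move=> Pu; rewrite -sub0r; apply: PB.
have PD u u' : P u -> P u' -> P (u + u').
  by move=> Pu Pu'; rewrite -[u']opprK; apply: (PB) => //; apply: PN.
have PZ k m n : P ((\pi_Q)%qT << k *g (m, n) >>).
  have -> : << k *g (m, n) >> = [m ⊗ n] *~ k.
    by apply/eqP/freeg_eqP => z; rewrite raddfMz /= !coeffU mul1r -mulrzl intz.
  rewrite raddfMz; case: k => k; rewrite ?NegzE ?mulrNz -pmulrn.
    by elim: k => [|k IH]; rewrite ?mulrS ?mulr0n //; apply: PD => //; apply: Pt.
  by apply: PN; elim: k.+1 => [|j IH]; rewrite ?mulrS ?mulr0n //; apply: PD => //; apply: Pt.
rewrite -[t]reprK -[repr t]freeg_sumE raddf_sum.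
by apply: (big_ind P) => // -[m n] _; apply: PZ.
Qed.

Definition balanced (W : zmodType) (f : M -> N -> W) : Prop :=
  [/\ forall m m' n, f (m + m') n = f m n + f m' n,
      forall m n n', f m (n + n') = f m n + f m n' &
      forall m s n, f (ract m s) n = f m (s *: n)].

Definition tensor_lift (W : zmodType) (f : M -> N -> W) (t : tensor) : W :=
  fglift (fun p => f p.1 p.2 : ssrint.zmodule W) (repr (t : Q)).

Section Lift.
Variables (W : zmodType) (f : M -> N -> W) (fb : balanced f).
Let F z : ssrint.zmodule W := fglift (fun p : M * N => f p.1 p.2 : ssrint.zmodule W) z.

Let FB z z' : F (z - z') = F z - F z'.
Proof. exact: lift_is_additive. Qed.

Let FE m n : F [m ⊗ n] = f m n.
Proof. by rewrite /F liftU scale1r. Qed.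

Let F0 z : z \in tensor_ker -> F z = 0.
Proof.
move=> /asboolP /(_ (fun z => F z = 0)); apply.
- by rewrite -(subrr 0) FB subrr.
- by move=> z1 z2 e1 e2; rewrite FB e1 e2 subrr.
have [fDl fDr fA] := fb.
move=> _ [m m' n|m n n'|m s n]; rewrite /= !FB !FE.
- by rewrite fDl addrAC addrK subrr.
- by rewrite fDr addrAC addrK subrr.
- by rewrite fA subrr.
Qed.

Let lift_pi z : tensor_lift f ((\pi_Q)%qT z) = F z.
Proof.
rewrite /tensor_lift -/(F _); apply/eqP; rewrite -subr_eq0 -FB; apply/eqP/F0.
by rewrite Quotient.idealrBE reprK.
Qed.

Lemma tensor_liftE m n : tensor_lift f (tens m n) = f m n.
Proof. by rewrite lift_pi FE. Qed.

Lemma tensor_lift_zmod_morphism : zmod_morphism (tensor_lift f).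
Proof.
move=> t t'; rewrite -[t]reprK -[t']reprK -[LHS]/(tensor_lift f (_ - _)).
have -> : (\pi_Q)%qT (repr t) - (\pi_Q)%qT (repr t')
   = (\pi_Q)%qT (repr t - repr t') :> tensor by rewrite [RHS]raddfB.
by rewrite !lift_pi FB.
Qed.

Lemma tensor_liftB t t' : tensor_lift f (t - t') = tensor_lift f t - tensor_lift f t'.
Proof. exact: tensor_lift_zmod_morphism. Qed.

Lemma tensor_lift0 : tensor_lift f 0 = 0.
Proof. by have := tensor_liftB 0 0; rewrite !subrr. Qed.

Lemma tensor_liftD t t' : tensor_lift f (t + t') = tensor_lift f t + tensor_lift f t'.
Proof.
by rewrite -{1}[t']opprK -[- t']sub0r 2!tensor_liftB tensor_lift0 sub0r opprK.
Qed.

Lemma tensor_lift_uniq (F' : tensor -> W) : zmod_morphism F' ->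
  (forall m n, F' (tens m n) = f m n) -> forall t, F' t = tensor_lift f t.
Proof.
move=> F'B e; apply: tensor_ind => [|t t' et et'|m n].
- by have := F'B 0 0; rewrite !subrr tensor_lift0.
- by rewrite F'B et et' tensor_liftB.
- by rewrite e tensor_liftE.
Qed.

End Lift.

Lemma tensor_ext (W : zmodType) (F F' : tensor -> W) :
  zmod_morphism F -> zmod_morphism F' ->
  (forall m n, F (tens m n) = F' (tens m n)) -> F =1 F'.
Proof.
move=> FB F'B e; apply: tensor_ind => [|t t' et et'|//].
- by have := FB 0 0; have := F'B 0 0; rewrite !subrr => -> ->.
- by rewrite FB F'B et et'.
Qed.

Fact tens_lact_balanced r : balanced (fun m n => tens (r *: m) n).
Proof.
split=> [m m' n|m n n'|m s n]; first by rewrite scalerDr tensDl.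
- by rewrite tensDr.
- by rewrite -ractZ tensA.
Qed.

Definition tensor_lact r : tensor -> tensor :=
  tensor_lift (fun m n => tens (r *: m) n).

Let lactE r m n : tensor_lact r (tens m n) = tens (r *: m) n.
Proof. exact: (tensor_liftE (tens_lact_balanced r)). Qed.

Let lactB r : zmod_morphism (tensor_lact r).
Proof. exact: (tensor_lift_zmod_morphism (tens_lact_balanced r)). Qed.

Let lactD r : right_distributive (fun _ : unit => tensor_lact r) +%R.
Proof. by move=> _ t t'; apply: (tensor_liftD (tens_lact_balanced r)). Qed.

Fact tensor_lactA r r' t : tensor_lact r (tensor_lact r' t) = tensor_lact (r * r') t.
Proof.
move: t; apply: tensor_ext => [t t'|t t'|m n]; rewrite ?lactB ?lactB //.
by rewrite !lactE scalerA.
Qed.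

Fact tensor_lact1 : left_id 1 tensor_lact.
Proof.
apply: tensor_ext => [t t'|t t'|m n]; rewrite ?lactB //.
by rewrite lactE scale1r.
Qed.

Fact tensor_lactDr : right_distributive tensor_lact +%R.
Proof. by move=> r t t'; apply: (lactD _ tt). Qed.

Fact tensor_lactDl t : {morph tensor_lact^~ t : r r' / r + r'}.
Proof.
move=> r r'; move: t.
apply: (@tensor_ext _ _ (fun t => tensor_lact r t + tensor_lact r' t))
  => [t t'|t t'|m n]; rewrite ?lactB //; first by rewrite addrACA opprD.
by rewrite !lactE scalerDl tensDl.
Qed.

HB.instance Definition _ := GRing.Zmodule_isLmodule.Build R tensor
  tensor_lactA tensor_lact1 tensor_lactDr tensor_lactDl.

Lemma tensZl r m n : r *: tens m n = tens (r *: m) n.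
Proof. exact: lactE. Qed.

End Tensor.

Section TensorRight.
Variables (R S T : pzRingType) (M : bimodType R S) (N : bimodType S T).
Local Notation MN := (tensor M N).

Fact tens_ract_balanced (c : T) : @balanced R S M N MN (fun m n => tens m (ract n c)).
Proof.
split=> [m m' n|m n n'|m s n]; first by rewrite tensDl.
- by rewrite ractDl tensDr.
- by rewrite ractZ tensA.
Qed.

Definition tensor_ract (t : MN) (c : T) : MN :=
  tensor_lift (fun m n => tens m (ract n c)) t.

Let ractE m n c : tensor_ract (tens m n) c = tens m (ract n c).
Proof. exact: (tensor_liftE (tens_ract_balanced c)). Qed.

Let ractB c : zmod_morphism (tensor_ract^~ c).
Proof. exact: (tensor_lift_zmod_morphism (tens_ract_balanced c)). Qed.

Fact tensor_ractDl c t t' : tensor_ract (t + t') c = tensor_ract t c + tensor_ract t' c.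
Proof. exact: (tensor_liftD (tens_ract_balanced c)). Qed.

Fact tensor_ractDr t c c' : tensor_ract t (c + c') = tensor_ract t c + tensor_ract t c'.
Proof.
move: t; apply: (@tensor_ext _ _ M N MN (tensor_ract^~ (c + c'))
   (fun t => tensor_ract t c + tensor_ract t c')) => [t t'|t t'|m n].
- exact: ractB.
- by rewrite !ractB addrACA opprD.
- by rewrite !ractE ractDr tensDr.
Qed.

Fact tensor_ractA t c c' : tensor_ract t (c * c') = tensor_ract (tensor_ract t c) c'.
Proof.
move: t; apply: (@tensor_ext _ _ M N MN (tensor_ract^~ (c * c'))
   (fun t => tensor_ract (tensor_ract t c) c')) => [t t'|t t'|m n].
- exact: ractB.
- by rewrite !ractB.
- by rewrite !ractE ractA.
Qed.

Fact tensor_ract1 t : tensor_ract t 1 = t.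
Proof.
move: t; apply: (@tensor_ext _ _ M N MN (tensor_ract^~ 1) id) => [t t'|//|m n].
- exact: ractB.
- by rewrite ractE ract1.
Qed.

Fact tensor_ractZ (r : R) (t : MN) c : tensor_ract (r *: t) c = r *: tensor_ract t c.
Proof.
move: t; apply: (@tensor_ext _ _ M N MN (fun t => tensor_ract (r *: t) c)
   (fun t => r *: tensor_ract t c)) => [t t'|t t'|m n].
- by rewrite scalerBr ractB.
- by rewrite ractB scalerBr.
- by rewrite !(ractE, tensZl).
Qed.

HB.instance Definition _ := Lmodule_isBimodule.Build R T MN
  tensor_ractDl tensor_ractDr tensor_ractA tensor_ract1 tensor_ractZ.

End TensorRight.

(** Additive maps from an [(R, R)]-bimodule to [R] commuting with both actions. *)
Definition bimodule_map (R : pzRingType) (M : bimodType R R) (f : M -> R) : Prop :=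
  [/\ zmod_morphism f, forall r m, f (r *: m) = r * f m &
      forall m r, f (ract m r) = f m * r].

Section Morita.
Variables (R S : pzRingType) (U : bimodType R S) (V : bimodType S R).
Variables (mu : tensor U V -> R) (nu : tensor V U -> S).

Definition morita_context : Prop :=
  [/\ bimodule_map mu, bimodule_map nu,
      forall u v u', ract u (nu (tens v u')) = mu (tens u v) *: u' &
      forall v u v', ract v (mu (tens u v')) = nu (tens v u) *: v'].

Definition strict_morita_context : Prop :=
  [/\ morita_context, bijective mu & bijective nu].

End Morita.

Record mod_functor (R S : pzRingType) := ModFunctor {
  fobj :> lmodType R -> lmodType S;
  fmap : forall M N : lmodType R, {linear M -> N} -> {linear fobj M -> fobj N};
  fmap_id : forall M : lmodType R, fmap (idfun : {linear M -> M}) =1 id;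
  fmap_comp : forall (L M N : lmodType R)
    (g : {linear M -> N}) (f : {linear L -> M}),
    fmap (g \o f : {linear L -> N}) =1 fmap g \o fmap f
}.

(** The composite of [F] followed by [G] is naturally isomorphic to the identity. *)
Definition comp_iso_id (R S : pzRingType)
    (F : mod_functor R S) (G : mod_functor S R) : Prop :=
  exists eta : forall M : lmodType R, {linear G (F M) -> M},
    (forall M, bijective (eta M)) /\
    (forall (M N : lmodType R) (f : {linear M -> N}) (m : G (F M)),
       eta N (fmap G (fmap F f) m) = f (eta M m)).

(** The categories of left modules are equivalent. *)
Definition morita_equivalent (R S : pzRingType) : Prop :=
  exists (F : mod_functor R S) (G : mod_functor S R),
    comp_iso_id F G /\ comp_iso_id G F.

Section SkewContext.
Variables (G : finGroupoid) (A : rngType) (D : set A).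
Variables (theta : unital_partial_action G D) (x : Ob G).
Local Notation R := (skew_ring theta).
Local Notation S := (skew_ring (res_uaction theta x)).

Definition skew_incl_fun (s : S) : {ffun G -> A} :=
  [ffun g => if insub g is Some h then s h else 0].

Fact skew_incl_subproof (s : S) : skew_incl_fun s \in skew_pred theta.
Proof.
apply/asboolP => g; rewrite ffunE; case: insubP => [h _ <-|_].
  exact: (skewP s h).
exact: ideal0 (pdom_ideal theta g).
Qed.

Definition skew_incl (s : S) : R := SkewRing (skew_incl_subproof s).

Definition skew_restr_fun (r : R) : {ffun isotropy x -> A} :=
  [ffun h : isotropy x => r (val h)].

Fact skew_restr_subproof (r : R) :
  skew_restr_fun r \in skew_pred (res_uaction theta x).
Proof. by apply/asboolP => h; rewrite ffunE; apply: skewP. Qed.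

Definition skew_restr (r : R) : S := SkewRing (skew_restr_subproof r).

Lemma skew_inclK : cancel skew_incl skew_restr.
Proof. by move=> s; apply: skew_eqP => h; rewrite !ffunE valK. Qed.

Lemma skew_inclD s s' : skew_incl (s + s') = skew_incl s + skew_incl s'.
Proof.
apply: skew_eqP => g; rewrite skewDE !ffunE; case: insub => [h|]; last by rewrite addr0.
by rewrite skewDE.
Qed.

Lemma skew_restrD r r' : skew_restr (r + r') = skew_restr r + skew_restr r'.
Proof. by apply: skew_eqP => h; rewrite skewDE !ffunE. Qed.

Lemma skew_incl_val s (h : isotropy x) : skew_incl s (val h) = s h.
Proof. by rewrite ffunE valK. Qed.

Lemma skew_incl_out s (g : G) : ~~ loop_at x g -> skew_incl s g = 0.
Proof. by move=> gx; rewrite ffunE insubN. Qed.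

Lemma skew_inclM s s' : skew_incl (s * s') = skew_incl s * skew_incl s'.
Proof.
apply: skew_eqP => k; rewrite [RHS]skew_mulE.
case: (boolP (loop_at x k)) => [kx|nkx]; last first.
  rewrite skew_incl_out // big1 // => g /eqP gk.
  case: (boolP (loop_at x g)) => [gx|ngx]; last by rewrite skew_incl_out ?rngmul0l.
  rewrite [X in tact _ _ X]skew_incl_out ?tact0 ?rngmul0r //.
  apply: contra nkx; case/andP: gx => /eqP sg /eqP tg.
  case/andP => /eqP s1 _; rewrite /loop_at -gk tg eqxx andbT.
  by rewrite src_comp ?src_inv // in s1; rewrite s1.
pose k' : isotropy x := mkLoop kx.
rewrite -[k]/(val k') skew_incl_val [LHS]skew_mulE.
have tk : tgt k = x by case/andP: (kx) => _ /eqP.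
rewrite [RHS](bigID (loop_at x)) /= [X in _ + X]big1 ?addr0; last first.
  by move=> g /andP[_ ngx]; rewrite skew_incl_out ?rngmul0l.
pose dflt := iso_idm x.
rewrite [RHS](reindex_onto (fun h : isotropy x => val h) (insubd dflt)); last first.
  by move=> g /andP[_ gx]; rewrite insubdK.
apply: eq_big => [h|h _].
  by rewrite (loopP h).2 tk !eqxx [loop_at _ _](valP h) valKd eqxx.
have e1 := skew_incl_val s h.
have e2 := skew_incl_val s' (iso_comp (iso_inv h) k').
by rewrite -e1 -e2.
Qed.

Local Notation e := (skew_incl 1).

Lemma skew_incl_idem : e * e = e.
Proof. by rewrite -skew_inclM mulr1. Qed.

Lemma skew_inclr s : skew_incl s * e = skew_incl s.
Proof. by rewrite -skew_inclM mulr1. Qed.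

Lemma skew_incll s : e * skew_incl s = skew_incl s.
Proof. by rewrite -skew_inclM mul1r. Qed.

Definition skewU_pred : {pred R} := fun r => `[< exists r', r = r' * e >].

Fact skewU_zmod_closed : zmod_closed skewU_pred.
Proof.
split=> [|r1 r2 /asboolP[r1' ->] /asboolP[r2' ->]]; apply/asboolP.
  by exists 0; rewrite mul0r.
by exists (r1' - r2'); rewrite mulrBl.
Qed.
HB.instance Definition _ := GRing.isZmodClosed.Build R skewU_pred skewU_zmod_closed.

Record skewU := SkewU { skewU_val :> R; _ : skewU_val \in skewU_pred }.
HB.instance Definition _ := [isSub for skewU_val].
HB.instance Definition _ := [Choice of skewU by <:].
HB.instance Definition _ := [SubChoice_isSubZmodule of skewU by <:].

Fact skewU_lact_subproof (r : R) (u : skewU) : r * u \in skewU_pred.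
Proof.
case: u => u /= /asboolP[r' ->]; apply/asboolP; exists (r * r'); exact: mulrA.
Qed.
Definition skewU_lact r u : skewU := SkewU (skewU_lact_subproof r u).

Fact skewU_lactA r r' u : skewU_lact r (skewU_lact r' u) = skewU_lact (r * r') u.
Proof. by apply: val_inj; rewrite /= mulrA. Qed.
Fact skewU_lact1 : left_id 1 skewU_lact.
Proof. by move=> u; apply: val_inj; rewrite /= mul1r. Qed.
Fact skewU_lactDr : right_distributive skewU_lact +%R.
Proof. by move=> r u u'; apply: val_inj; rewrite /= mulrDr. Qed.
Fact skewU_lactDl u : {morph skewU_lact^~ u : r r' / r + r'}.
Proof. by move=> r r'; apply: val_inj; rewrite /= mulrDl. Qed.
HB.instance Definition _ := GRing.Zmodule_isLmodule.Build R skewU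
  skewU_lactA skewU_lact1 skewU_lactDr skewU_lactDl.

Fact skewU_ract_subproof (u : skewU) (s : S) : (u : R) * skew_incl s \in skewU_pred.
Proof.
by apply/asboolP; exists ((u : R) * skew_incl s); rewrite -mulrA skew_inclr.
Qed.
Definition skewU_ract u s : skewU := SkewU (skewU_ract_subproof u s).

Lemma skewU_mul1 (u : skewU) : (u : R) * e = u.
Proof.
case: u => u /= /asboolP[r ->]; by rewrite -mulrA skew_incl_idem.
Qed.

Fact skewU_ractDl s u u' : skewU_ract (u + u') s = skewU_ract u s + skewU_ract u' s.
Proof. by apply: val_inj; rewrite /= mulrDl. Qed.
Fact skewU_ractDr u s s' : skewU_ract u (s + s') = skewU_ract u s + skewU_ract u s'.
Proof. by apply: val_inj; rewrite /= skew_inclD mulrDr. Qed.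
Fact skewU_ractA u s s' : skewU_ract u (s * s') = skewU_ract (skewU_ract u s) s'.
Proof. by apply: val_inj; rewrite /= skew_inclM mulrA. Qed.
Fact skewU_ract1 u : skewU_ract u 1 = u.
Proof. by apply: val_inj; rewrite /= skewU_mul1. Qed.
Fact skewU_ractZ (r : R) (u : skewU) s : skewU_ract (r *: u) s = r *: skewU_ract u s.
Proof. by apply: val_inj; rewrite /= mulrA. Qed.
HB.instance Definition _ := Lmodule_isBimodule.Build R S skewU
  skewU_ractDl skewU_ractDr skewU_ractA skewU_ract1 skewU_ractZ.

Definition skewV_pred : {pred R} := fun r => `[< exists r', r = e * r' >].

Fact skewV_zmod_closed : zmod_closed skewV_pred.
Proof.
split=> [|r1 r2 /asboolP[r1' ->] /asboolP[r2' ->]]; apply/asboolP.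
  by exists 0; rewrite mulr0.
by exists (r1' - r2'); rewrite mulrBr.
Qed.
HB.instance Definition _ := GRing.isZmodClosed.Build R skewV_pred skewV_zmod_closed.

Record skewV := SkewV { skewV_val :> R; _ : skewV_val \in skewV_pred }.
HB.instance Definition _ := [isSub for skewV_val].
HB.instance Definition _ := [Choice of skewV by <:].
HB.instance Definition _ := [SubChoice_isSubZmodule of skewV by <:].

Fact skewV_lact_subproof (s : S) (v : skewV) : skew_incl s * v \in skewV_pred.
Proof.
by apply/asboolP; exists (skew_incl s * v); rewrite mulrA skew_incll.
Qed.
Definition skewV_lact s v : skewV := SkewV (skewV_lact_subproof s v).

Lemma skewV_mul1 (v : skewV) : e * v = v.
Proof.
case: v => v /= /asboolP[r ->]; by rewrite mulrA skew_incl_idem.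
Qed.

Fact skewV_lactA s s' v : skewV_lact s (skewV_lact s' v) = skewV_lact (s * s') v.
Proof. by apply: val_inj; rewrite /= skew_inclM mulrA. Qed.
Fact skewV_lact1 : left_id 1 skewV_lact.
Proof. by move=> v; apply: val_inj; rewrite /= skewV_mul1. Qed.
Fact skewV_lactDr : right_distributive skewV_lact +%R.
Proof. by move=> s v v'; apply: val_inj; rewrite /= mulrDr. Qed.
Fact skewV_lactDl v : {morph skewV_lact^~ v : s s' / s + s'}.
Proof. by move=> s s'; apply: val_inj; rewrite /= skew_inclD mulrDl. Qed.
HB.instance Definition _ := GRing.Zmodule_isLmodule.Build S skewV
  skewV_lactA skewV_lact1 skewV_lactDr skewV_lactDl.

Fact skewV_ract_subproof (v : skewV) (r : R) : (v : R) * r \in skewV_pred.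
Proof.
by case: v => v /= /asboolP[r' ->]; apply/asboolP; exists (r' * r); rewrite mulrA.
Qed.
Definition skewV_ract v r : skewV := SkewV (skewV_ract_subproof v r).

Fact skewV_ractDl r v v' : skewV_ract (v + v') r = skewV_ract v r + skewV_ract v' r.
Proof. by apply: val_inj; rewrite /= mulrDl. Qed.
Fact skewV_ractDr v r r' : skewV_ract v (r + r') = skewV_ract v r + skewV_ract v r'.
Proof. by apply: val_inj; rewrite /= mulrDr. Qed.
Fact skewV_ractA v r r' : skewV_ract v (r * r') = skewV_ract (skewV_ract v r) r'.
Proof. by apply: val_inj; rewrite /= mulrA. Qed.
Fact skewV_ract1 v : skewV_ract v 1 = v.
Proof. by apply: val_inj; rewrite /= mulr1. Qed.
Fact skewV_ractZ (s : S) (v : skewV) r : skewV_ract (s *: v) r = s *: skewV_ract v r.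
Proof. by apply: val_inj; rewrite /= mulrA. Qed.
HB.instance Definition _ := Lmodule_isBimodule.Build S R skewV
  skewV_ractDl skewV_ractDr skewV_ractA skewV_ract1 skewV_ractZ.

Definition skew_mu : tensor skewU skewV -> R :=
  tensor_lift (fun (u : skewU) (v : skewV) => (u : R) * (v : R)).

Definition skew_nu : tensor skewV skewU -> S :=
  tensor_lift (fun (v : skewV) (u : skewU) => skew_restr ((v : R) * (u : R))).

Fact skew_mu_balanced :
  balanced (fun (u : skewU) (v : skewV) => (u : R) * (v : R)).
Proof.
split=> [u u' v|u v v'|u s v] /=; first by rewrite mulrDl.
- by rewrite mulrDr.
- by rewrite mulrA.
Qed.

Fact skew_nu_balanced :
  balanced (fun (v : skewV) (u : skewU) => skew_restr ((v : R) * (u : R))).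
Proof.
split=> [v v' u|v u u'|v r u] /=; first by rewrite mulrDl skew_restrD.
- by rewrite mulrDr skew_restrD.
- by rewrite mulrA.
Qed.

Lemma skew_muE (u : skewU) (v : skewV) : skew_mu (tens u v) = (u : R) * (v : R).
Proof. exact: (tensor_liftE skew_mu_balanced). Qed.

Lemma skew_incl1E (g : G) : e g = if g == idm x then pone theta g else 0.
Proof.
rewrite ffunE; case: insubP => [h _ <-|ng]; rewrite ?ffunE; last first.
  by case: eqP ng => // ->; rewrite iso_idm_subproof.
by rewrite /= -(inj_eq val_inj).
Qed.

Lemma skew_mull1 (r : R) (g : G) : tgt g != x -> (e * r) g = 0.
Proof.
move=> gx; rewrite [LHS]skew_mulE big1 // => h /eqP hg.
rewrite skew_incl1E ifN ?rngmul0l //.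
by apply: contra gx => /eqP hx; rewrite -hg hx tgt_idm.
Qed.

Lemma skew_mulr1' (r : R) (g : G) : src g != x -> (r * e) g = 0.
Proof.
move=> gx; rewrite [LHS]skew_mulE big1 // => h /eqP hg.
rewrite skew_incl1E ifN ?tact0 ?rngmul0r //.
apply: contra gx => /eqP /(congr1 (@src G)).
by rewrite src_comp ?src_inv // src_idm => ->.
Qed.

(** [skew_nu] maps [v ⊗ u] to the product [v u], which lies in [S]. *)
Lemma skew_nuE (v : skewV) (u : skewU) :
  skew_incl (skew_nu (tens v u)) = (v : R) * (u : R).
Proof.
rewrite /skew_nu (tensor_liftE skew_nu_balanced).
set r := (v : R) * (u : R); apply: skew_eqP => g.
case: (boolP (loop_at x g)) => [gx|].
  by rewrite -[g]/(val (mkLoop gx)) skew_incl_val ffunE.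
move=> ngx; rewrite skew_incl_out //; case/nandP: ngx => gx.
  by rewrite /r -skewU_mul1 mulrA skew_mulr1'.
by rewrite /r -skewV_mul1 -mulrA skew_mull1.
Qed.

End SkewContext.

Arguments skew_mu {G A D} theta x _.
Arguments skew_nu {G A D} theta x _.

(* Main.v *)
Require Import Defs.
From HB Require Import structures.
From mathcomp Require Import all_boot all_algebra.
From mathcomp Require Import boolp classical_sets functions.

(** Write [e = 1_S]. Since [B_{tau_y} = I_y = B_y], the elements
    [u_y = 1_y delta_{tau_y}] and [v_y = 1_x delta_{tau_y^-1}] satisfy
    [u_y = u_y e], [v_y = e v_y] and [sum_y u_y v_y = 1_R]: the idempotent [e]
    is full. Thus [r |-> sum_y u_y (x) v_y r] inverts [mu], while
    [s |-> e (x) s] inverts [nu] because [S = e R e]. As for any Morita context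
    with [mu] and [nu] surjective, tensoring with [V] and [U] yields the
    equivalence of the module categories. *)

Set Implicit Arguments.
Unset Strict Implicit.
Unset Printing Implicit Defensive.

Import GRing.Theory.
Local Open Scope ring_scope.
Local Open Scope classical_set_scope.

(** * Tensoring with a bimodule as a functor on left modules *)

Lemma ractB (R S : pzRingType) (M : bimodType R S) (m m' : M) s :
  ract (m - m') s = ract m s - ract m' s.
Proof. by apply/eqP; rewrite eq_sym subr_eq -ractDl subrK. Qed.

Lemma tens_ractE (R S T : pzRingType) (M : bimodType R S) (N : bimodType S T)
  (m : M) (n : N) c : ract (tens m n) c = tens m (ract n c).
Proof. exact: (tensor_liftE (tens_ract_balanced M N c)). Qed.

Section TensorMap.
Variables (R S : pzRingType) (U : bimodType R S).

Definition tens_map (M N : lmodType S) (f : {linear M -> N}) : tensor U M -> tensor U N :=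
  tensor_lift (fun u m => tens u (f m)).

Section Linear.
Variables (M N : lmodType S) (f : {linear M -> N}).

Fact tens_map_balanced : balanced (fun (u : U) (m : M) => tens u (f m)).
Proof. by split=> *; rewrite ?linearD ?linearZ (tensDl, tensDr, tensA). Qed.

Lemma tens_mapE u m : tens_map f (tens u m) = tens u (f m).
Proof. exact: (tensor_liftE tens_map_balanced). Qed.

Fact tens_map_zmod_morphism : zmod_morphism (tens_map f).
Proof. exact: (tensor_lift_zmod_morphism tens_map_balanced). Qed.
HB.instance Definition _ :=
  GRing.isZmodMorphism.Build _ _ (tens_map f) tens_map_zmod_morphism.

Fact tens_map_scalable : scalable (tens_map f).
Proof.
move=> r t; move: t; apply: tensor_ind => [|t t' et et'|u m].
- by rewrite !(scaler0, raddf0).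
- by rewrite !(scalerBr, raddfB) /= et et'.
- by rewrite tensZl !tens_mapE tensZl.
Qed.
HB.instance Definition _ :=
  GRing.isScalable.Build R _ _ _ (tens_map f) tens_map_scalable.

Definition tens_fmap : {linear tensor U M -> tensor U N} := tens_map f.

End Linear.

Fact tens_fmap_id (M : lmodType S) : tens_fmap (idfun : {linear M -> M}) =1 id.
Proof.
by apply: tensor_ext => // [|u m]; [exact: raddfB | rewrite [LHS]tens_mapE].
Qed.

Fact tens_fmap_comp (L M N : lmodType S) (g : {linear M -> N}) (f : {linear L -> M}) :
  tens_fmap (g \o f : {linear L -> N}) =1 tens_fmap g \o tens_fmap f.
Proof.
apply: tensor_ext => [| t t' | u m]; first exact: raddfB.
- by rewrite /= !raddfB.
- by rewrite [LHS]tens_mapE /= [in RHS]tens_mapE [RHS]tens_mapE.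
Qed.

Definition tens_functor : mod_functor S R :=
  ModFunctor tens_fmap_id tens_fmap_comp.

End TensorMap.

(** * The counit of a Morita context *)

Section MoritaCounit.
Variables (R S : pzRingType) (U : bimodType R S) (V : bimodType S R).
Variables (mu : tensor U V -> R) (nu : tensor V U -> S).
Hypothesis hmn : morita_context mu nu.

Let muB : zmod_morphism mu. Proof. by case: hmn => -[]. Qed.
Let muZ r t : mu (r *: t) = r * mu t. Proof. by case: hmn => -[]. Qed.
Let mur t r : mu (ract t r) = mu t * r. Proof. by case: hmn => -[]. Qed.
Let mu0 : mu 0 = 0. Proof. by have := muB 0 0; rewrite !subrr. Qed.
Let muD t t' : mu (t + t') = mu t + mu t'.
Proof. by rewrite -[t' in LHS]opprK -[- t']sub0r !muB mu0 sub0r opprK. Qed.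

Section Component.
Variable M : lmodType R.

(** The evaluation of [U (x) (V (x) M)] in [M] is lifted one tensor sign at a time. With [u] fixed,
    balance over [R] is the right linearity of [mu]; balance over [S], in [u], then comes from the
    relations of [U (x) V]. *)
Definition counit_at (u : U) : tensor V M -> M :=
  tensor_lift (fun v m => mu (tens u v) *: m).

Fact counit_at_balanced u : balanced (fun (v : V) (m : M) => mu (tens u v) *: m).
Proof.
split=> [v v' m|v m m'|v r m]; first by rewrite tensDr muD scalerDl.
- by rewrite scalerDr.
- by rewrite -tens_ractE mur scalerA.
Qed.

Lemma counit_atE u v m : counit_at u (tens v m) = mu (tens u v) *: m.
Proof. exact: (tensor_liftE (counit_at_balanced u)). Qed.

Fact counit_atB u : zmod_morphism (counit_at u).
Proof. exact: (tensor_lift_zmod_morphism (counit_at_balanced u)). Qed.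

Definition counit : tensor U (tensor V M) -> M := tensor_lift counit_at.

Fact counit_balanced : balanced counit_at.
Proof.
split=> [u u' t|u t t'|u s t].
- move: t; apply: (@tensor_ext _ _ V M M _ (fun t => counit_at u t + counit_at u' t))
    => [t t'|t t'|v m]; rewrite ?counit_atB ?opprD 1?addrACA //.
  by rewrite !counit_atE tensDl muD scalerDl.
- exact: (tensor_liftD (counit_at_balanced u)).
- move: t; apply: (@tensor_ext _ _ V M M _ (fun t => counit_at u (s *: t)))
    => [t t'|t t'|v m]; rewrite ?scalerBr ?counit_atB //.
  by rewrite tensZl !counit_atE tensA.
Qed.

Lemma counitE u t : counit (tens u t) = counit_at u t.
Proof. exact: (tensor_liftE counit_balanced). Qed.

Fact counitB : zmod_morphism counit.
Proof. exact: (tensor_lift_zmod_morphism counit_balanced). Qed.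

Fact counit_scalable : scalable counit.
Proof.
move=> r z; move: z; apply: tensor_ind => [|z z' ez ez'|u t].
- by rewrite scaler0 /counit (tensor_lift0 counit_balanced) scaler0.
- by rewrite !(scalerBr, counitB) ez ez'.
rewrite tensZl !counitE; move: t.
apply: (@tensor_ext _ _ V M M _ (fun t => r *: counit_at u t))
  => [t t'|t t'|v m]; rewrite ?counit_atB ?scalerBr //.
by rewrite !counit_atE -tensZl muZ scalerA.
Qed.

Definition counit_linear : {linear tensor U (tensor V M) -> M} :=
  HB.pack counit
    (GRing.isZmodMorphism.Build _ _ counit counitB)
    (GRing.isScalable.Build R _ _ _ counit counit_scalable).

(** As a function of [t], this is the reassociation of [t (x) m]. As a function of [m], with [t]
    fixed such that [mu t = 1], it will be the inverse of [counit]. *)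
Definition tensA_at (m : M) : tensor U V -> tensor U (tensor V M) :=
  tensor_lift (fun u v => tens u (tens v m)).

Fact tensA_at_balanced (m : M) : balanced (fun (u : U) (v : V) => tens u (tens v m)).
Proof.
by split=> [u u' v|u v v'|u s v]; rewrite ?tensDl ?tensDr // tensA tensZl.
Qed.

Lemma tensA_atE m u v : tensA_at m (tens u v) = tens u (tens v m).
Proof. exact: (tensor_liftE (tensA_at_balanced m)). Qed.

Fact tensA_atB m : zmod_morphism (tensA_at m).
Proof. exact: (tensor_lift_zmod_morphism (tensA_at_balanced m)). Qed.

Lemma tensA_at_zmod_morphism t : zmod_morphism (tensA_at^~ t).
Proof.
move=> m m'; move: t.
apply: (@tensor_ext _ _ U V _ _ (fun t => tensA_at m t - tensA_at m' t))
  => [t t'|t t'|u v]; first exact: tensA_atB.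
  by rewrite !tensA_atB !opprD addrACA.
rewrite !tensA_atE; apply/eqP; rewrite eq_sym subr_eq -tensDr -tensDr.
by rewrite subrK.
Qed.

(** Both sides are additive in [t], so pure tensors suffice. Keeping [t] arbitrary, instead of
    imposing [mu t = 1], is what permits this reduction. *)
Lemma counitK t m : counit (tensA_at m t) = mu t *: m.
Proof.
move: t; apply: (@tensor_ext _ _ U V M (fun t => counit (tensA_at m t))
  (fun t => mu t *: m)) => [t t'|t t'|u v].
- by rewrite tensA_atB counitB.
- by rewrite muB scalerBl.
- by rewrite tensA_atE counitE counit_atE.
Qed.

(* u_i (x) v_i (x) mu(u (x) v) m = u_i nu(v_i (x) u) (x) v (x) m
   = mu(u_i (x) v_i) u (x) v (x) m *)
Lemma tensA_atK t z : tensA_at (counit z) t = mu t *: z.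
Proof.
have [_ _ munu numu] := hmn.
move: z; apply: (@tensor_ext _ _ U (tensor V M) _ (fun z => tensA_at (counit z) t)
  (fun z => mu t *: z)) => [z z'|z z'|u w].
- by rewrite counitB; apply: tensA_at_zmod_morphism.
- by rewrite scalerBr.
rewrite counitE tensZl; move: w.
apply: (@tensor_ext _ _ V M _ (fun w => tensA_at (counit_at u w) t)
  (fun w => tens (mu t *: u) w)) => [w w'|w w'|v m].
- by rewrite counit_atB; apply: tensA_at_zmod_morphism.
- by apply/eqP; rewrite eq_sym subr_eq -tensDr subrK.
rewrite counit_atE; move: t.
apply: (@tensor_ext _ _ U V _ (fun t => tensA_at (mu (tens u v) *: m) t)
  (fun t => tens (mu t *: u) (tens v m))) => [t t'|t t'|u' v'].
- exact: tensA_atB.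
- by apply/eqP; rewrite muB scalerBl eq_sym subr_eq -tensDl subrK.
by rewrite tensA_atE -tensA numu -(tensZl _ v) -tensA munu.
Qed.

(** Both composites of [counit] and [m |-> tensA_at m t] are multiplication by [mu t]. *)
Lemma counit_bij t : mu t = 1 -> bijective counit.
Proof.
move=> mut; exists (tensA_at^~ t) => z.
  by rewrite tensA_atK mut scale1r.
by rewrite counitK mut scale1r.
Qed.

End Component.

Lemma counit_comp_iso_id t : mu t = 1 ->
  comp_iso_id (tens_functor V) (tens_functor U).
Proof.
move=> mut; exists counit_linear; split=> [M|M N f].
  exact: counit_bij mut.
(* The naturality square is restated with the bare functions behind [fmap] and [counit_linear], so
   that it can be checked on pure tensors. *)
suff nat (z : tensor U (tensor V M)) :
  counit (tens_map (tens_fmap V f) z) = f (counit z) by exact: nat.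
move: z; apply: (@tensor_ext _ _ U (tensor V M) N
  (fun z => counit (tens_map (tens_fmap V f) z)) (fun z => f (counit z)))
  => [z z'|z z'|u w].
- by rewrite tens_map_zmod_morphism counitB.
- by rewrite counitB raddfB.
rewrite tens_mapE !counitE; move: w.
apply: (@tensor_ext _ _ V M N (fun w => counit_at u (tens_map f w))
  (fun w => f (counit_at u w))) => [w w'|w w'|v m].
- by rewrite tens_map_zmod_morphism counit_atB.
- by rewrite counit_atB raddfB.
- by rewrite tens_mapE !counit_atE linearZ.
Qed.

End MoritaCounit.

(** * From strict contexts to equivalences of module categories *)

Lemma morita_context_sym (R S : pzRingType) (U : bimodType R S) (V : bimodType S R)
    (mu : tensor U V -> R) (nu : tensor V U -> S) :
  morita_context mu nu -> morita_context nu mu.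
Proof. by case=> ? ? munu numu; split. Qed.

(** Bijectivity of [mu] provides a preimage of 1, hence an invertible counit for one composite; [nu]
    and the symmetric context handle the other. *)
Theorem strict_morita_equivalent (R S : pzRingType) (U : bimodType R S)
    (V : bimodType S R) (mu : tensor U V -> R) (nu : tensor V U -> S) :
  strict_morita_context mu nu -> morita_equivalent R S.
Proof.
case=> hmn [mu' _ muK] [nu' _ nuK].
exists (tens_functor V), (tens_functor U); split.
  exact: counit_comp_iso_id hmn (mu' 1) (muK 1).
exact: counit_comp_iso_id (morita_context_sym hmn) (nu' 1) (nuK 1).
Qed.


(** * The elements [1_g delta_g] and the fullness of [1_S] *)

Section SkewMorita.
Variables (G : finGroupoid) (A : rngType) (D : set A).
Variable theta : unital_partial_action G D.
Local Notation R := (skew_ring theta).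

Definition skew_delta_fun (g : G) : {ffun G -> A} :=
  [ffun k => if k == g then pone theta g else 0].

Fact skew_delta_subproof g : skew_delta_fun g \in skew_pred theta.
Proof.
apply/asboolP => k; rewrite ffunE; case: eqP => [->|_]; first exact: pone_mem.
exact: ideal0 (pdom_ideal theta k).
Qed.

Definition skew_delta g : R := SkewRing (skew_delta_subproof g).

Lemma skew_deltaM g h : src g = tgt h -> forall k,
  (skew_delta g * skew_delta h) k =
    if k == gcomp g h then tact theta g (pone theta h) else 0.
Proof.
move=> gh k; rewrite [LHS]skew_mulE; case: eqP => [->|nk].
  rewrite (bigD1 g) ?tgt_comp //= big1 ?addr0.
    rewrite !ffunE eqxx compKl // eqxx pone1l //; apply: tact_mem.
    by rewrite gh; apply: pdom_tgt; apply: pone_mem.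
  by move=> i /andP[_ /negPf ni]; rewrite ffunE ni rngmul0l.
(* A nonzero term requires [i = g] and [g^-1 k = h], hence [k = gh], which is excluded here. *)
rewrite big1 // => i /eqP ik; rewrite !ffunE.
case: eqP => [ig|_]; last by rewrite rngmul0l.
case: eqP => [ih|_]; last by rewrite tact0 rngmul0r.
by case: nk; rewrite -ih ig compVKl // -ig.
Qed.

(** The coefficient is [theta_g(1_{g^-1})], because [1_{s(g)}] fixes [B_{g^-1}]; a ring isomorphism
    carries identity to identity, so this is [1_g]. *)
Lemma skew_deltaM_src g : skew_delta g * skew_delta (idm (src g)) = skew_delta g.
Proof.
apply: skew_eqP => k; rewrite skew_deltaM ?tgt_idm // comp_idr ffunE.
case: eqP => // _; rewrite /tact pone1l; last exact/pdomV_src/pone_mem.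
apply: is_identity_uniq (poneP theta g).
exact: iso_identity (pact_iso theta g) (poneP theta (ginv g)).
Qed.

(** The coefficient is [1_g], in general smaller than [1_{t(g)}]. The two agree when
    [B_g = B_{t(g)}], which is what [tau_full] provides along the transversal. *)
Lemma skew_deltaMV g k : (skew_delta g * skew_delta (ginv g)) k =
  if k == idm (tgt g) then pone theta g else 0.
Proof.
rewrite skew_deltaM ?tgt_inv // comp_invr; case: eqP => // _.
rewrite tactE; last exact: pone_mem.
apply: is_identity_uniq (poneP theta g).
exact: iso_identity (pact_iso theta g) (poneP theta (ginv g)).
Qed.

Lemma skew_incl1_delta x : skew_incl (1 : skew_ring (res_uaction theta x)) = skew_delta (idm x).
Proof. by apply: skew_eqP => k; rewrite skew_incl1E ffunE; case: eqP => // ->. Qed.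

Section Transversal.
Variables (x : Ob G) (tau : base_transversal x).
Hypothesis tau_full : forall y, pdom theta (tau y) = pdom theta (idm y).
Local Notation e := (skew_incl (1 : skew_ring (res_uaction theta x))).

Lemma skew_delta_e y : skew_delta (tau y) * e = skew_delta (tau y).
Proof. by rewrite skew_incl1_delta -{2}(src_trv tau y) skew_deltaM_src. Qed.

Lemma skew_transversal_sum :
  \sum_y skew_delta (tau y) * skew_delta (ginv (tau y)) = 1.
Proof.
apply: skew_eqP => k; rewrite [RHS]ffunE.
have -> (F : Ob G -> R) : (\sum_y F y) k = \sum_y F y k.
  by elim/big_rec2: _ => [|y a b _ <-]; rewrite ?skew0E ?skewDE.
under eq_bigr => y _ do rewrite skew_deltaMV tgt_trv.
case: eqP => [kx|nk]; last first.
  by rewrite big1 // => y _; case: eqP => // ky; case: nk; rewrite ky src_idm.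
rewrite (bigD1 (src k)) //= -kx eqxx big1 ?addr0.
  (* [pone] depends only on the underlying ring, so equal domains have the same identity. *)
  by rewrite /pone tau_full -kx.
move=> y /eqP ny; case: eqP => // ky; case: ny.
by rewrite ky src_idm.
Qed.

End Transversal.

(** * The Morita context attached to the idempotent [1_S] *)

Section Context.
Variable x : Ob G.
Local Notation S := (skew_ring (res_uaction theta x)).
Local Notation e := (skew_incl (1 : S)).
Local Notation U := (skewU theta x).
Local Notation V := (skewV theta x).
Local Notation mu := (skew_mu theta x).
Local Notation nu := (skew_nu theta x).

Lemma skew_mu_zmod_morphism : zmod_morphism mu.
Proof. exact: (tensor_lift_zmod_morphism (skew_mu_balanced theta x)). Qed.

Lemma skew_nu_zmod_morphism : zmod_morphism nu.
Proof. exact: (tensor_lift_zmod_morphism (skew_nu_balanced theta x)). Qed.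

Lemma skew_mu_bimodule_map : bimodule_map mu.
Proof.
split=> [|r t|t r]; first exact: skew_mu_zmod_morphism.
- move: t; apply: (@tensor_ext _ _ U V _ (fun t => mu (r *: t)) (fun t => r * mu t))
    => [t t'|t t'|u v].
  + by rewrite scalerBr skew_mu_zmod_morphism.
  + by rewrite skew_mu_zmod_morphism mulrBr.
  + by rewrite tensZl !skew_muE mulrA.
- move: t; apply: (@tensor_ext _ _ U V _ (fun t => mu (ract t r)) (fun t => mu t * r))
    => [t t'|t t'|u v].
  + by rewrite ractB skew_mu_zmod_morphism.
  + by rewrite skew_mu_zmod_morphism mulrBl.
  + by rewrite tens_ractE !skew_muE mulrA.
Qed.

Lemma skew_nu_bimodule_map : bimodule_map nu.
Proof.
split=> [|s t|t s]; first exact: skew_nu_zmod_morphism.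
- move: t; apply: (@tensor_ext _ _ V U _ (fun t => nu (s *: t)) (fun t => s * nu t))
    => [t t'|t t'|v u].
  + by rewrite scalerBr skew_nu_zmod_morphism.
  + by rewrite skew_nu_zmod_morphism mulrBr.
  (* Values of [nu] are plain products once included in [R], so the equation in [S] is compared
     there. *)
  + apply: (can_inj (@skew_inclK _ _ _ theta x)).
    by rewrite tensZl skew_inclM !skew_nuE mulrA.
- move: t; apply: (@tensor_ext _ _ V U _ (fun t => nu (ract t s)) (fun t => nu t * s))
    => [t t'|t t'|v u].
  + by rewrite ractB skew_nu_zmod_morphism.
  + by rewrite skew_nu_zmod_morphism mulrBl.
  + apply: (can_inj (@skew_inclK _ _ _ theta x)).
    by rewrite tens_ractE skew_inclM !skew_nuE mulrA.
Qed.

Lemma skew_morita_context : morita_context mu nu.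
Proof.
split; [exact: skew_mu_bimodule_map | exact: skew_nu_bimodule_map | |].
- by move=> u v u'; apply: val_inj; rewrite /= skew_nuE skew_muE mulrA.
- by move=> v u v'; apply: val_inj; rewrite /= skew_nuE skew_muE mulrA.
Qed.

Fact skewU_in_subproof (r : R) : r * e \in @skewU_pred _ _ _ theta x.
Proof. by apply/asboolP; exists r. Qed.
Definition skewU_in r : U := SkewU (skewU_in_subproof r).

Fact skewV_in_subproof (r : R) : e * r \in @skewV_pred _ _ _ theta x.
Proof. by apply/asboolP; exists r. Qed.
Definition skewV_in r : V := SkewV (skewV_in_subproof r).

Lemma skew_nu_bij : bijective nu.
Proof.
exists (fun s => tens (skewV_in 1) (skewU_in (skew_incl s))) => [|s].
  apply: (@tensor_ext _ _ V U _
    (fun t => tens (skewV_in 1) (skewU_in (skew_incl (nu t)))) id) => [t t'|//|v u].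
    apply/eqP; rewrite skew_nu_zmod_morphism eq_sym subr_eq -tensDr.
    apply/eqP; congr tens; apply: val_inj.
    by rewrite /= -mulrDl -skew_inclD subrK.
  (* The product [vu] is the scalar [v] of [R] acting on [u]; it crosses the tensor sign over [R],
     and [e v = v]. *)
  have -> : skewU_in (skew_incl (nu (tens v u))) = (v : R) *: u.
    by apply: val_inj; rewrite /= skew_nuE -mulrA skewU_mul1.
  rewrite -tensA; congr tens; apply: val_inj.
  by rewrite /= mulr1 skewV_mul1.
apply: (can_inj (@skew_inclK _ _ _ theta x)).
by rewrite skew_nuE /= mulr1 skew_inclr skew_incll.
Qed.

(** The decomposition of 1 is used twice: it rebuilds [r] from the products [u_i v_i r], and it
    rebuilds [u'] from the products [u_i v_i u'] inside a tensor. *)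
Lemma skew_mu_bij (I : finType) (u : I -> U) (v : I -> V) :
  \sum_i (u i : R) * (v i : R) = 1 -> bijective mu.
Proof.
move=> uv1; pose inv (r : R) : tensor U V := \sum_i tens (u i) (ract (v i) r).
have invB : zmod_morphism inv.
  move=> r r'; rewrite /inv -sumrB; apply: eq_bigr => i _.
  by apply/eqP; rewrite eq_sym subr_eq -tensDr -ractDr subrK.
have mu_sum (F : I -> tensor U V) : mu (\sum_i F i) = \sum_i mu (F i).
  elim/big_rec2: _ => [|i a b _ <-].
    by have := skew_mu_zmod_morphism 0 0; rewrite !subrr.
  by apply/eqP; rewrite -subr_eq -skew_mu_zmod_morphism addrK.
exists inv => [|r].
  apply: (@tensor_ext _ _ U V _ (fun t => inv (mu t)) id); [|by []|] => [t t'|u' v'].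
    by rewrite skew_mu_zmod_morphism invB.
  have tens_suml (F : I -> U) :
      \sum_i tens (F i) v' = tens (\sum_i F i) v'.
    elim/big_rec2: _ => [|i a b _ ->]; last by rewrite tensDl.
    by apply: (addrI (tens 0 v')); rewrite -tensDl !addr0.
  (* Each [v_i u'] lies in [S], so it moves to the left of the tensor sign over [S]. *)
  transitivity (\sum_i tens (ract (u i) (nu (tens (v i) u'))) v').
    apply: eq_bigr => i _; rewrite tensA; congr tens; apply: val_inj.
    by rewrite skew_muE /= skew_nuE mulrA.
  rewrite tens_suml; congr tens.
  rewrite -[RHS]scale1r -uv1 scaler_suml; apply: eq_bigr => i _.
  by apply: val_inj; rewrite /= skew_nuE mulrA.
rewrite mu_sum -[RHS]mul1r -uv1 mulr_suml; apply: eq_bigr => i _.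
by rewrite skew_muE /= mulrA.
Qed.

End Context.

Lemma skew_strict_morita_context x (tau : base_transversal x) :
  (forall y, pdom theta (tau y) = pdom theta (idm y)) ->
  strict_morita_context (skew_mu theta x) (skew_nu theta x).
Proof.
move=> tau_full; split; [exact: skew_morita_context | | exact: skew_nu_bij].
(* [skewU_in] and [skewV_in] put [e e] between the two factors; idempotence and [skew_delta_e]
   absorb it. *)
apply: (@skew_mu_bij x _ (fun y => skewU_in x (skew_delta (tau y)))
  (fun y => skewV_in x (skew_delta (ginv (tau y))))).
rewrite -(skew_transversal_sum tau_full); apply: eq_bigr => y _ /=.
by rewrite mulrA -[X in X * _]mulrA skew_incl_idem skew_delta_e.
Qed.

End SkewMorita.

(** * The extension of [gamma] along the transversal *)

(** The loop attached to [tau_y] is the identity of [x], and [gamma_{tau_x}] is the identity of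
    [I_x]. Hence [theta_{tau_y}] is [gamma_{tau_y}] itself, with range [I_{tau_y} = I_y]. *)
Lemma Ext_pdom_transversal (G : finGroupoid) (x : Ob G) (tau : base_transversal x)
    (A : rngType) (gamma : Dobject tau A) (y : Ob G) :
  dJ gamma y = dI gamma x -> dK gamma y = dI gamma y ->
  pdom (Ext gamma) (tau y) = pdom (Ext gamma) (idm y).
Proof.
(* [ext_pbij] treats identities separately; if [tau_y] is one, it equals [idm y]. *)
move=> hJ hK; case: (eqVneq (tau y) (idm (src (tau y)))) => [e|ne].
  by rewrite -[in RHS](tgt_trv tau y) e tgt_idm.
rewrite /= prange_ext_id /ext_pbij (negPf ne) src_trv tgt_trv.
have -> : base_loop tau (tau y) = iso_idm x.
  apply: val_inj; rewrite /= src_trv tgt_trv trv_base.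
  by rewrite compKl ?src_trv ?tgt_idm.
(* The identity loop is its own inverse; [tt] is the single object of the isotropy group. *)
have domV : pdom (dgam gamma) (iso_inv (iso_idm x)) = dI gamma x.
  by rewrite -[RHS]dgam_base; congr pdom; exact: (@inv_idm (isotropy x) tt).
have act1 a : dI gamma x a -> pact (dgam gamma) (iso_idm x) a = a.
  by move=> Ia; apply: (@pact_idm _ _ _ (dgam gamma) tt); rewrite /= dgam_base.
have [bijx _ _] := dsig_iso gamma x.
have [K1 _ _] := set_bij_pinv bijx.
(* The chosen inverse of [gamma_{tau_x}] is controlled only on its range, here all of [I_x]. *)
have pinv1 a : dI gamma x a -> 'pinv_(fun=> 0) (dJ gamma x) (dsig gamma x) a = a.
  by move=> Ia; rewrite -{1}[a](dsig_base Ia) K1 // dJ_base.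
have rx : dsig gamma x @` dJ gamma x = dI gamma x.
  rewrite dJ_base; apply/seteqP; split=> [_ [a Ia <-]|a Ia]; first by rewrite dsig_base.
  by exists a; rewrite // dsig_base.
have [[fJK _ fS] _ _] := dsig_iso gamma y; rewrite hJ hK in fJK fS.
apply/seteqP; split=> [_ [a [ra _] <-]|b /fS[a Ia <-]].
  have Ia : dI gamma x a by rewrite -rx.
  by rewrite /= pinv1 // act1 //; apply: fJK.
(* A preimage of [b] under [gamma_{tau_y}] also works for the composite, whose other two factors fix
   [I_x]; it remains to check its source factor by factor. *)
exists a; last by rewrite /= pinv1 ?act1.
split; first by rewrite -rx in Ia.
rewrite /preimage /= pinv1 //; split; first by rewrite /= domV.
by rewrite /preimage /= act1 // hJ.
Qed.

Theorem theorem5p7 (G : finGroupoid) (hG : connected_groupoid G) (x : Ob G)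
    (tau : base_transversal x) (A : rngType) (gamma : Dobject tau A)
    (hJK : forall y : Ob G,
       dJ gamma y = dI gamma x /\ dK gamma y = dI gamma y)
    (hx : is_unital (dI gamma x))
    (hu : unital_action (dgam gamma))
    (hA : direct_sum (dI gamma)) :
  let theta := UnitalPartialAction (Ext_unital hJK hu) in
  strict_morita_context (skew_mu theta x) (skew_nu theta x) /\
  morita_equivalent (skew_ring theta) (skew_ring (res_uaction theta x)).
Proof.
move=> theta; have ctx : strict_morita_context (skew_mu theta x) (skew_nu theta x).
  apply: (@skew_strict_morita_context _ _ _ _ _ tau) => y.
  by have [hJ hK] := hJK y; apply: Ext_pdom_transversal.
by split=> //; apply: strict_morita_equivalent ctx.
Qed.
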